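(* For all $\tau\in\mathbb{H}$ and all $z\in\mathbb{C}$, $$\vartheta_1\left(\frac{z}{\tau},\frac{-1}{\tau}\right)= -i\,(-i\tau)^{1/2}\, e^{\pi i z^2/\tau}\,\vartheta_1(z,\tau).$$
   Context: $\mathbb{H}=\{x+iy: x,y\in\mathbb{R},\ y>0\}$ is the upper half-plane. For $\tau\in\mathbb{H}$ and $z\in\mathbb{C}$, put $q=e^{\pi i\tau}$, $q^{1/4}=e^{\pi i\tau/4}$ and $w=e^{\pi i z}$, and define $$\vartheta_1(z,\tau) = -i\, w\, q^{1/4} \prod_{n=1}^{\infty} (1-q^{2n})(1- w^2 q^{2n})(1- w^{-2} q^{2n-2}).$$ Complex powers are principal: for $s\in\mathbb{C}\setminus\{0\}$ and $x\in\mathbb{C}$, $s^x=e^{x\log s}$ with $-\pi<\arg(s)\le\pi$. *)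

(* Defs.v *)
From Stdlib Require Import Reals Lra.
From Coquelicot Require Import Coquelicot.

Open Scope R_scope.

(** Complex exponential, and the principal logarithm and powers *)

Definition Cexp (s : C) : C :=
  (RtoC (exp (Re s)) * (cos (Im s), sin (Im s)))%C.

(** The value at [0] is irrelevant. *)
Definition Carg (s : C) : R :=
  if Rle_dec 0 (Im s) then acos (Re s / Cmod s) else - acos (Re s / Cmod s).

Definition Clog (s : C) : C := (ln (Cmod s), Carg s).

(** [Cpow], written [^], is Coquelicot's power with a natural exponent. *)
Definition Cpower (s x : C) : C := Cexp (x * Clog s)%C.

Lemma Carg_spec (s : C) : s <> RtoC 0 ->
  - PI < Carg s <= PI /\
  s = (RtoC (Cmod s) * (cos (Carg s), sin (Carg s)))%C.
Proof.
intros Hs.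
assert (Hm : 0 < Cmod s) by (apply Cmod_gt_0; exact Hs).
assert (Hsq : Cmod s * Cmod s = Re s * Re s + Im s * Im s).
{ unfold Cmod, Re, Im. rewrite sqrt_sqrt; [ring | nra]. }
set (r := Re s / Cmod s).
assert (Hr : Re s = r * Cmod s) by (unfold r; field; lra).
assert (Hi : Im s * Im s = (1 - r²) * (Cmod s)²) by (unfold Rsqr; nra).
assert (Hb : -1 <= r <= 1).
{ assert (0 <= 1 - r²).
  { apply Rmult_le_reg_r with ((Cmod s)²);
      [apply Rlt_0_sqr; lra | rewrite <- Hi; nra]. }
  unfold Rsqr in *; split; nra. }
assert (Hsin : sin (acos r) * Cmod s = Rabs (Im s)).
{ rewrite sin_acos by exact Hb.
  rewrite <- (sqrt_Rsqr (Cmod s)) by lra.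
  rewrite <- sqrt_mult_alt by (unfold Rsqr; nra).
  rewrite <- sqrt_Rsqr_abs. f_equal. unfold Rsqr in *. nra. }
pose proof (acos_bound r) as [Ha0 Ha1].
pose proof PI_RGT_0 as HPI.
assert (Hc : cos (acos r) = r) by (apply cos_acos; exact Hb).
unfold Carg; fold r.
destruct (Rle_dec 0 (Im s)) as [H | H].
- split; [lra |].
  rewrite Rabs_pos_eq in Hsin by exact H.
  rewrite Hc.
  apply injective_projections; unfold Cmult, RtoC; simpl;
    unfold Re, Im in *; nra.
- assert (Hneq : acos r <> PI).
  { intro E. rewrite E, sin_PI, Rmult_0_l in Hsin.
    symmetry in Hsin. apply Rabs_no_R0 in Hsin; [exact Hsin | lra]. }
  split; [lra |].
  rewrite Rabs_left in Hsin by lra.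
  rewrite cos_neg, sin_neg, Hc.
  apply injective_projections; unfold Cmult, RtoC; simpl;
    unfold Re, Im in *; nra.
Qed.

(** [Cprod f N] is the product of [f n] over [1 <= n <= N]. *)
Fixpoint Cprod (f : nat -> C) (N : nat) : C :=
  match N with
  | O => RtoC 1
  | S M => (Cprod f M * f (S M))%C
  end.

(** Product of [f n] over [n >= 1]. As usual with Coquelicot's total limits,
    the value is meaningful only when the partial products converge. *)
Definition Cinfprod (f : nat -> C) : C :=
  C_complete_lim (filtermap (Cprod f) eventually).

Lemma Cinfprod_unique (f : nat -> C) (l : C) :
  filterlim (Cprod f) eventually (locally l) -> Cinfprod f = l.
Proof.
intros Hl.
apply (filterlim_locally_unique (V := C_R_NormedModule) (Cprod f) (F := eventually));
  [| exact Hl].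
apply filterlim_locally. intros eps.
apply (C_complete_ax1 (filtermap (Cprod f) eventually)).
- apply filtermap_proper_filter, eventually_filter.
- intros e. exists l.
  exact (proj1 (filterlim_locally (Cprod f) l) Hl e).
Qed.

(** The factor [q ^ (2 * n - 2)] is only used for [n >= 1], where the
    subtraction of naturals is exact. *)
Definition theta1 (z tau : C) : C :=
  let q := Cexp (PI * Ci * tau) in
  let q4 := Cexp (PI * Ci * tau / 4) in
  let w := Cexp (PI * Ci * z) in
  (- Ci * w * q4 *
   Cinfprod (fun n => (1 - q ^ (2 * n)) * (1 - w ^ 2 * q ^ (2 * n))
                      * (1 - / (w ^ 2) * q ^ (2 * n - 2))))%C.

Definition upper_half_plane (tau : C) : Prop := 0 < Im tau.

(* Main.v *)
(* The infinite product for theta1(z, tau) is a row-by-row evaluation, through the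
   product for the sine, of the product of (1 - z^2/w^2) over the nonzero lattice
   points w = m + n tau up to sign.  Inversion of tau exchanges the order of the two
   limits.  This product converges only conditionally, but in the quotient of its
   values at z1, z2 and z3 with z1^2 + z2^2 = z3^2 the terms in 1/w^2 cancel, so that
   the order is irrelevant there.  Hence G(z) = theta1(z/tau, -1/tau) e^(-pi i z^2/tau)
   satisfies F(z1) F(z2) G(z3) = c G(z1) G(z2) F(z3), where F = theta1(-, tau) and c
   does not depend on the z's.  As F and G change sign under z -> z + 1, the choice
   z1 = u, z2 = z, z3 = u + 1 with 2u + 1 = z^2 gives G = F / c.

   The constant is the quotient of the values of eta^3 at -1/tau and tau, up to a
   factor tau.  Multiplying the inversions at the three half periods, where the product
   of the thetas is a power of eta by Euler's identity, determines its square; its sign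
   is then fixed by continuity in tau and the fixed point tau = i. *)

Require Import Defs.
From Stdlib Require Import Reals Lra Lia Psatz Classical Ranalysis5.
From Coquelicot Require Import Coquelicot.

Open Scope R_scope.

(** * Limits in the complex plane *)

(** The eta factor is split off because the product divided by the squares [(1 - qnome tau ^ n) ^ 2]
    is, row by row, exactly a product of factors 1 - z^2/w^2; [theta] is this normalised product.
    For w = m + n tau or m - n tau with m, n >= 1, a bound |w|^2 >= d m n turns the error O(w^-4) of
    the quotient into O(1/(m^2 n^2)), a product of summable majorants, which is what the exchange of
    limits asks for. The two axes, where m n = 0, are treated apart through the sine product. The
    constant c is tau: the lattice factors are invariant under scaling, while dividing the z's by
    tau divides z1 z2 / z3 by tau. The Gaussian respects the relation because z1^2 + z2^2 = z3^2
    makes it multiplicative; it is there to cancel the quasi-period factor of theta under z -> z +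
    1. The factors at z3 are divided by, so z3 and u have to avoid the lattice. If 2u + 1 = z^2
    fails to provide this, z3 = u + 2 with 4u + 4 = z^2 serves instead, and the two sign changes
    cancel. *)

Definition tends {T : Type} (F : (T -> Prop) -> Prop) (f : T -> C) (l : C) : Prop :=
  forall eps, 0 < eps -> F (fun t => Cmod (f t - l)%C < eps).

Lemma tends_const {T} F {FF : Filter F} (c : C) : tends F (fun _ : T => c) c.
Proof.
intros eps He. apply filter_forall. intros _.
replace (c - c)%C with (RtoC 0) by ring. rewrite Cmod_0. exact He.
Qed.

Lemma tends_ext_loc {T} F {FF : Filter F} (f g : T -> C) l :
  F (fun t => f t = g t) -> tends F f l -> tends F g l.
Proof.
intros Hfg Hf eps He.
generalize (filter_and _ _ Hfg (Hf eps He)). apply filter_imp.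
intros t [E H]. rewrite <- E. exact H.
Qed.

Lemma tends_ext {T} F {FF : Filter F} (f g : T -> C) l :
  (forall t, f t = g t) -> tends F f l -> tends F g l.
Proof. intros H. apply (tends_ext_loc F). now apply filter_forall. Qed.

Lemma tends_plus {T} F {FF : Filter F} (f g : T -> C) l m :
  tends F f l -> tends F g m -> tends F (fun t => f t + g t)%C (l + m)%C.
Proof.
intros Hf Hg eps He.
assert (He2 : 0 < eps / 2) by lra.
generalize (filter_and _ _ (Hf _ He2) (Hg _ He2)).
apply filter_imp. intros t [H1 H2].
replace (f t + g t - (l + m))%C with ((f t - l) + (g t - m))%C by ring.
pose proof (Cmod_triangle (f t - l) (g t - m)). lra.
Qed.

Lemma tends_mult {T} F {FF : Filter F} (f g : T -> C) l m :
  tends F f l -> tends F g m -> tends F (fun t => f t * g t)%C (l * m)%C.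
Proof.
intros Hf Hg eps He.
pose proof (Cmod_ge_0 l) as Hl. pose proof (Cmod_ge_0 m) as Hm.
set (d := Rmin 1 (eps / (Cmod l + Cmod m + 2))).
assert (Hq : 0 < eps / (Cmod l + Cmod m + 2)) by (apply Rdiv_lt_0_compat; lra).
assert (Hd : 0 < d) by (apply Rmin_glb_lt; lra).
generalize (filter_and _ _ (Hf d Hd) (Hg d Hd)).
apply filter_imp. intros t [H1 H2].
replace (f t * g t - l * m)%C
  with ((f t - l) * (g t - m) + ((f t - l) * m + l * (g t - m)))%C by ring.
eapply Rle_lt_trans; [apply Cmod_triangle |].
eapply Rle_lt_trans; [apply Rplus_le_compat_l, Cmod_triangle |].
rewrite !Cmod_mult.
pose proof (Cmod_ge_0 (f t - l)). pose proof (Cmod_ge_0 (g t - m)).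
assert (Hd1 : d <= 1) by apply Rmin_l.
assert (Hd2 : d * (Cmod l + Cmod m + 2) <= eps).
{ apply Rle_trans with (eps / (Cmod l + Cmod m + 2) * (Cmod l + Cmod m + 2)).
  - apply Rmult_le_compat_r; [lra | apply Rmin_r].
  - right. field. lra. }
assert (Cmod (f t - l) * Cmod (g t - m) <= d * 1) by (apply Rmult_le_compat; lra).
assert (Cmod (f t - l) * Cmod m <= d * Cmod m) by (apply Rmult_le_compat_r; lra).
assert (Cmod l * Cmod (g t - m) <= Cmod l * d) by (apply Rmult_le_compat_l; lra).
nra.
Qed.

Lemma tends_opp {T} F {FF : Filter F} (f : T -> C) l :
  tends F f l -> tends F (fun t => - f t)%C (- l)%C.
Proof.
intros Hf. apply (tends_ext F (fun t => - (1) * f t)%C); [intros; ring |].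
replace (- l)%C with (- (1) * l)%C by ring.
apply (tends_mult F); [apply (tends_const F) | exact Hf].
Qed.

Lemma tends_minus {T} F {FF : Filter F} (f g : T -> C) l m :
  tends F f l -> tends F g m -> tends F (fun t => f t - g t)%C (l - m)%C.
Proof. intros. apply (tends_plus F); [assumption | now apply (tends_opp F)]. Qed.

Lemma tends_inv {T} F {FF : Filter F} (f : T -> C) l : l <> RtoC 0 ->
  tends F f l -> tends F (fun t => / f t)%C (/ l)%C.
Proof.
intros Hl Hf eps He.
assert (Hm : 0 < Cmod l) by now apply Cmod_gt_0.
set (d := Rmin (Cmod l / 2) (eps * (Cmod l * Cmod l) / 2)).
assert (Hd : 0 < d).
{ apply Rmin_glb_lt; [lra |]. apply Rdiv_lt_0_compat; [|lra].
  apply Rmult_lt_0_compat; [lra | nra]. }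
generalize (Hf d Hd). apply filter_imp. intros t H.
assert (H1 : d <= Cmod l / 2) by apply Rmin_l.
assert (H2 : d <= eps * (Cmod l * Cmod l) / 2) by apply Rmin_r.
assert (Hft : Cmod l / 2 < Cmod (f t)).
{ pose proof (Cmod_triangle (f t) (- (f t - l))) as Ht.
  rewrite Cmod_opp in Ht.
  replace (f t + - (f t - l))%C with l in Ht by ring. lra. }
assert (Hft0 : f t <> RtoC 0) by (apply Cmod_gt_0; lra).
replace (/ f t - / l)%C with (- (f t - l) / (f t * l))%C by (field; auto).
rewrite Cmod_div by now apply Cmult_neq_0.
rewrite Cmod_opp, Cmod_mult.
apply Rmult_lt_reg_r with (Cmod (f t) * Cmod l); [nra |].
unfold Rdiv. rewrite Rmult_assoc, Rinv_l by nra. rewrite Rmult_1_r.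
apply Rlt_le_trans with (1 := H). apply Rle_trans with (1 := H2).
nra.
Qed.

Lemma tends_div {T} F {FF : Filter F} (f g : T -> C) l m : m <> RtoC 0 ->
  tends F f l -> tends F g m -> tends F (fun t => f t / g t)%C (l / m)%C.
Proof. intros. apply (tends_mult F); [assumption | now apply (tends_inv F)]. Qed.

Lemma tends_unique {T} F {FF : ProperFilter F} (f : T -> C) l m :
  tends F f l -> tends F f m -> l = m.
Proof.
intros Hl Hm.
destruct (Req_dec (Cmod (l - m)) 0) as [E | E].
- apply Cmod_eq_0 in E. replace l with (l - m + m)%C by ring. rewrite E. ring.
- pose proof (Cmod_ge_0 (l - m)).
  assert (He : 0 < Cmod (l - m) / 2) by lra.
  destruct (filter_ex _ (filter_and _ _ (Hl _ He) (Hm _ He))) as [t [H1 H2]].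
  exfalso. pose proof (Cmod_triangle (- (f t - l)) (f t - m)) as Ht.
  rewrite Cmod_opp in Ht.
  replace (- (f t - l) + (f t - m))%C with (l - m)%C in Ht by ring. lra.
Qed.

Lemma tends_Cmod_le {T} F {FF : ProperFilter F} (f : T -> C) l b :
  tends F f l -> F (fun t => Cmod (f t) <= b) -> Cmod l <= b.
Proof.
intros Hl Hb. apply Rnot_lt_le. intros H.
assert (He : 0 < Cmod l - b) by lra.
destruct (filter_ex _ (filter_and _ _ (Hl _ He) Hb)) as [t [H1 H2]].
pose proof (Cmod_triangle (- (f t - l)) (f t)) as Ht.
rewrite Cmod_opp in Ht.
replace (- (f t - l) + f t)%C with l in Ht by ring. lra.
Qed.

Lemma tends_0_le {T} F {FF : Filter F} (f : T -> C) (b : T -> R) :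
  (forall t, Cmod (f t) <= b t) -> tends F (fun t => RtoC (b t)) 0 -> tends F f 0.
Proof.
intros Hfb Hb eps He. generalize (Hb eps He). apply filter_imp. intros t H.
replace (f t - 0)%C with (f t) by ring.
replace (RtoC (b t) - 0)%C with (RtoC (b t)) in H by ring.
rewrite Cmod_R in H. pose proof (Rle_abs (b t)). specialize (Hfb t). lra.
Qed.

Lemma tends_comp {T U} (F : (T -> Prop) -> Prop) (G : (U -> Prop) -> Prop)
  (h : T -> U) (f : U -> C) l :
  filterlim h F G -> tends G f l -> tends F (fun t => f (h t)) l.
Proof. intros Hh Hf eps He. exact (Hh _ (Hf eps He)). Qed.

Lemma tends_subseq (h : nat -> nat) (f : nat -> C) l :
  (forall n, (n <= h n)%nat) -> tends eventually f l ->
  tends eventually (fun n => f (h n)) l.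
Proof.
intros Hh. apply tends_comp. intros P [N HN]. exists N. intros n Hn.
apply HN. specialize (Hh n). lia.
Qed.

Lemma tends_incr_1 (f : nat -> C) l :
  tends eventually (fun n => f (S n)) l -> tends eventually f l.
Proof.
intros H eps He. destruct (H eps He) as [N HN]. exists (S N).
intros [|n] Hn; [lia | apply HN; lia].
Qed.

Lemma tends_RtoC (u : nat -> R) (l : R) :
  is_lim_seq u l -> tends eventually (fun n => RtoC (u n)) l.
Proof.
intros H eps He. apply is_lim_seq_spec in H.
destruct (H (mkposreal eps He)) as [N HN]. exists N. intros n Hn.
rewrite <- RtoC_minus, Cmod_R. now apply HN.
Qed.

Lemma tends_inv_INR : tends eventually (fun n => RtoC (/ INR (S n))) 0.
Proof.
apply tends_RtoC.
apply (is_lim_seq_incr_1 (fun n => / INR n)).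
replace (Finite 0) with (Rbar_inv p_infty) by reflexivity.
apply is_lim_seq_inv; [apply is_lim_seq_INR | discriminate].
Qed.

Lemma tends_pow_0 (x : C) : Cmod x < 1 -> tends eventually (fun n => x ^ n)%C 0.
Proof.
intros Hx. apply (tends_0_le eventually) with (b := fun n => Cmod x ^ n).
- intros n. rewrite Cmod_pow. lra.
- apply tends_RtoC, is_lim_seq_geom.
  rewrite Rabs_pos_eq; [exact Hx | apply Cmod_ge_0].
Qed.

Lemma tends_filterlim (f : nat -> C) (l : C) :
  tends eventually f l -> filterlim f eventually (locally l).
Proof.
intros H. apply filterlim_locally. intros [eps He]. simpl.
generalize (H eps He). apply filter_imp. intros n Hn.
now apply C_NormedModule_mixin_compat1.
Qed.

(** The increments form a series dominated by [b], hence convergent by completeness, and its partial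
    sums telescope to [a (S n) - a 0]. *)
Lemma ex_series_tends (a : nat -> C) (b : nat -> R) :
  (forall n, Cmod (a (S n) - a n)%C <= b n) -> ex_series b ->
  exists l, tends eventually a l.
Proof.
intros Hab Hb.
assert (Hex : ex_series (V := C_R_CompleteNormedModule) (fun n => a (S n) - a n)%C).
{ apply ex_series_le with (b := b); [|exact Hb].
  intros n. specialize (Hab n). rewrite Cmod_norm in Hab. exact Hab. }
destruct Hex as [l Hl]. exists (l + a 0%nat)%C.
apply tends_incr_1. intros eps He.
assert (He2 : 0 < eps / 2) by lra.
generalize (proj1 (filterlim_locally _ _) Hl (mkposreal _ He2)).
apply filter_imp. intros n Hn.
assert (E : sum_n (G := C_R_CompleteNormedModule) (fun n => a (S n) - a n)%C n
            = (a (S n) - a 0%nat)%C).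
{ clear. induction n as [|n IH]; [now rewrite sum_O |].
  rewrite sum_Sn, IH.
  change (a (S n) - a 0%nat + (a (S (S n)) - a (S n)) = a (S (S n)) - a 0%nat)%C.
  ring. }
assert (Hb' : ball (M := C_UniformSpace) l (mkposreal _ He2) (a (S n) - a 0%nat)%C)
  by (rewrite <- E; exact Hn).
(* Balls of [C] are coordinate boxes; returning to [Cmod] costs a factor [sqrt 2 <= 2], which is why
   the radius is [eps / 2]. *)
apply C_NormedModule_mixin_compat2 in Hb'. simpl in Hb'.
replace (a (S n) - (l + a 0%nat))%C with (a (S n) - a 0%nat - l)%C by ring.
eapply Rlt_le_trans; [exact Hb' |].
assert (sqrt 2 <= 2) by (apply Rsqr_incr_0_var; unfold Rsqr; [rewrite sqrt_sqrt |]; lra).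
nra.
Qed.

(** * Infinite products *)

Lemma Cprod_ext (f g : nat -> C) N :
  (forall k, (1 <= k <= N)%nat -> f k = g k) -> Cprod f N = Cprod g N.
Proof.
induction N as [|N IH]; intros H; simpl; [reflexivity |].
rewrite IH, H; [reflexivity | lia | intros; apply H; lia].
Qed.

Lemma Cprod_mult (f g : nat -> C) N :
  Cprod (fun k => f k * g k)%C N = (Cprod f N * Cprod g N)%C.
Proof. induction N as [|N IH]; simpl; [ring | rewrite IH; ring]. Qed.

Lemma Cprod_neq_0 (f : nat -> C) N :
  (forall k, (1 <= k <= N)%nat -> f k <> RtoC 0) -> Cprod f N <> RtoC 0.
Proof.
induction N as [|N IH]; intros H; simpl; [exact C1_nz |].
apply Cmult_neq_0; [apply IH; intros; apply H; lia | apply H; lia].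
Qed.

Lemma Cprod_1 (f : nat -> C) N :
  (forall k, (1 <= k <= N)%nat -> f k = RtoC 1) -> Cprod f N = RtoC 1.
Proof.
induction N as [|N IH]; intros H; simpl; [reflexivity |].
rewrite IH, H; [ring | lia | intros; apply H; lia].
Qed.

Lemma Cprod_inv (f : nat -> C) N :
  (forall k, (1 <= k)%nat -> f k <> RtoC 0) ->
  Cprod (fun k => / f k)%C N = (/ Cprod f N)%C.
Proof.
intros H. induction N as [|N IH]; simpl; [field; exact C1_nz |].
rewrite IH. field. split; [apply H; lia | apply Cprod_neq_0; intros; apply H; lia].
Qed.

Lemma Cprod_exchange (f : nat -> nat -> C) M N :
  Cprod (fun n => Cprod (fun m => f m n) M) N = Cprod (fun m => Cprod (fun n => f m n) N) M.
Proof.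
induction N as [|N IH]; simpl; [now rewrite Cprod_1 |].
now rewrite IH, <- Cprod_mult.
Qed.

(** * Summable majorants and convergence of products *)

Fixpoint Rsum (u : nat -> R) (N : nat) : R :=
  match N with
  | O => 0
  | S M => Rsum u M + u (S M)
  end.

(** A majorant for the factors of a [Cprod]: the series starts at index 1 because [Cprod] does. *)
Definition summable (u : nat -> R) : Prop :=
  (forall k, 0 <= u k) /\ ex_series (fun k => u (S k)).

Lemma Rsum_sum_n u N : Rsum u (S N) = sum_n (fun k => u (S k)) N.
Proof.
induction N as [|N IH]; [rewrite sum_O; simpl; ring |].
rewrite sum_Sn, <- IH. reflexivity.
Qed.

Lemma summable_lim u : summable u -> exists U, is_lim_seq (Rsum u) (Finite U).
Proof.
intros [_ [U HU]]. exists U. apply is_lim_seq_incr_1.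
apply is_lim_seq_ext with (2 := HU). intros N. symmetry. apply Rsum_sum_n.
Qed.

Lemma Rsum_incr u N p : (forall k, 0 <= u k) -> Rsum u N <= Rsum u (N + p).
Proof.
intros Hu. induction p as [|p IH]; [rewrite Nat.add_0_r; lra |].
rewrite Nat.add_succ_r. simpl. specialize (Hu (S (N + p))). lra.
Qed.

Lemma Rsum_le_lim u U N : (forall k, 0 <= u k) -> is_lim_seq (Rsum u) (Finite U) -> Rsum u N <= U.
Proof.
intros Hu HU. apply (is_lim_seq_incr_compare (Rsum u) U HU).
intros n. simpl. specialize (Hu (S n)). lra.
Qed.

Lemma summable_scal c u : 0 <= c -> summable u -> summable (fun k => c * u k).
Proof.
intros Hc [Hu Hs]. split; [intros k; specialize (Hu k); nra |].
exact (ex_series_scal c _ Hs).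
Qed.

Lemma summable_geom r : 0 <= r < 1 -> summable (fun k => r ^ k).
Proof.
intros Hr. split; [intros k; apply pow_le; lra |].
apply -> (ex_series_incr_1 (fun k => r ^ k)). apply ex_series_geom. rewrite Rabs_pos_eq; lra.
Qed.

Lemma Cprod_Cmod_le f u N :
  (forall k, (1 <= k)%nat -> Cmod (f k - 1)%C <= u k) ->
  Cmod (Cprod f N) <= exp (Rsum u N).
Proof.
intros H. induction N as [|N IH]; simpl.
- rewrite Cmod_1, exp_0. lra.
- rewrite Cmod_mult, exp_plus.
  assert (Cmod (f (S N)) <= exp (u (S N))).
  { pose proof (Cmod_triangle (f (S N) - 1) 1) as Ht.
    replace (f (S N) - 1 + 1)%C with (f (S N)) in Ht by ring.
    rewrite Cmod_1 in Ht. specialize (H (S N) ltac:(lia)).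
    pose proof (exp_ineq1_le (u (S N))). lra. }
  apply Rmult_le_compat; auto using Cmod_ge_0.
Qed.

(** Each factor has modulus at most 1 + u <= exp(u), so one step moves the product by at most exp(S)
    u <= exp(S + u) - exp(S), with S the sum so far. These differences telescope. *)
Lemma Cprod_dist f u M p :
  (forall k, (1 <= k)%nat -> Cmod (f k - 1)%C <= u k) ->
  Cmod (Cprod f (M + p) - Cprod f M)%C <= exp (Rsum u (M + p)) - exp (Rsum u M).
Proof.
intros H. induction p as [|p IH].
- rewrite Nat.add_0_r. replace (Cprod f M - Cprod f M)%C with (RtoC 0) by ring.
  rewrite Cmod_0. lra.
- rewrite Nat.add_succ_r. simpl. set (n := (M + p)%nat) in *.
  replace (Cprod f n * f (S n) - Cprod f M)%C
    with (Cprod f n * (f (S n) - 1) + (Cprod f n - Cprod f M))%C by ring.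
  eapply Rle_trans; [apply Cmod_triangle |].
  rewrite Cmod_mult, exp_plus.
  pose proof (Cprod_Cmod_le f u n H). specialize (H (S n) ltac:(lia)).
  assert (Cmod (Cprod f n) * Cmod (f (S n) - 1) <= exp (Rsum u n) * u (S n))
    by (apply Rmult_le_compat; auto using Cmod_ge_0).
  pose proof (exp_ineq1_le (u (S n))). pose proof (exp_pos (Rsum u n)). nra.
Qed.

Lemma Cprod_tends f u : summable u ->
  (forall k, (1 <= k)%nat -> Cmod (f k - 1)%C <= u k) ->
  tends eventually (Cprod f) (Cinfprod f).
Proof.
intros Hu H. destruct (summable_lim u Hu) as [U HU].
cut (exists l, tends eventually (Cprod f) l).
{ intros [l Hl]. now rewrite (Cinfprod_unique f l (tends_filterlim _ _ Hl)). }
(* The steps of [exp (Rsum u _)] telescope, with total [exp U - 1]. *)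
apply ex_series_tends with (b := fun n => exp (Rsum u (S n)) - exp (Rsum u n)).
- intros n. pose proof (Cprod_dist f u n 1 H) as Hd.
  rewrite Nat.add_1_r in Hd. exact Hd.
- exists (exp U - 1).
  assert (HE : is_lim_seq (fun n => exp (Rsum u (S n))) (Finite (exp U))).
  { apply is_lim_seq_continuous.
    - apply derivable_continuous_pt, derivable_pt_exp.
    - now apply -> is_lim_seq_incr_1. }
  assert (HE1 : is_lim_seq (fun n => exp (Rsum u (S n)) - 1) (Finite (exp U - 1)))
    by (apply is_lim_seq_minus' with (1 := HE), is_lim_seq_const).
  apply is_lim_seq_ext with (2 := HE1). intros n.
  induction n as [|n IH].
  + rewrite sum_O. simpl. rewrite exp_0. reflexivity.
  + rewrite sum_Sn, <- IH. unfold plus; simpl. ring.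
Qed.

(* Moore-Osgood: a summable majorant makes the convergence in [k] uniform in [t]. *)
Lemma Cprod_limit_exchange {T} F {PF : ProperFilter F}
  (f : T -> nat -> C) (u : nat -> R) (l : nat -> C) (g : T -> C) (L : C) :
  summable u ->
  F (fun t => (forall k, (1 <= k)%nat -> Cmod (f t k - 1)%C <= u k) /\
              tends eventually (Cprod (f t)) (g t)) ->
  (forall k, (1 <= k)%nat -> tends F (fun t => f t k) (l k)) ->
  tends eventually (Cprod l) L ->
  tends F g L.
Proof.
intros Hu Hf Hl HL.
assert (Hlu : forall k, (1 <= k)%nat -> Cmod (l k - 1)%C <= u k).
{ intros k Hk. apply (tends_Cmod_le F (fun t => f t k - 1)%C).
  - apply (tends_minus F); [now apply Hl | apply (tends_const F)].
  - generalize Hf. apply filter_imp. intros t [H _]. now apply H. }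
assert (HM : forall M, tends F (fun t => Cprod (f t) M) (Cprod l M)).
{ induction M as [|M IH]; simpl; [apply (tends_const F) |].
  apply (tends_mult F); [exact IH | apply Hl; lia]. }
destruct (summable_lim u Hu) as [U HU].
assert (Htail : forall h a, (forall k, (1 <= k)%nat -> Cmod (h k - 1)%C <= u k) ->
  tends eventually (Cprod h) a ->
  forall M, Cmod (a - Cprod h M)%C <= exp U - exp (Rsum u M)).
{ intros h a Hh Ha M.
  apply (tends_Cmod_le eventually (fun N => Cprod h N - Cprod h M)%C).
  - apply (tends_minus eventually); [exact Ha | apply (tends_const eventually)].
  - exists M. intros N HN. replace N with (M + (N - M))%nat by lia.
    eapply Rle_trans; [exact (Cprod_dist h u M (N - M) Hh) |].
    pose proof (Rsum_le_lim u U (M + (N - M)) (proj1 Hu) HU) as Hle.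
    apply Rplus_le_compat_r. destruct Hle as [Hlt | ->]; [left; now apply exp_increasing | lra]. }
intros eps He.
assert (HE : is_lim_seq (fun n => exp (Rsum u n)) (Finite (exp U))).
{ apply is_lim_seq_continuous with (2 := HU).
  apply derivable_continuous_pt, derivable_pt_exp. }
apply is_lim_seq_spec in HE.
assert (He3 : 0 < eps / 3) by lra.
destruct (HE (mkposreal _ He3)) as [M HE']. simpl in HE'.
specialize (HE' M (le_n M)). apply Rabs_def2 in HE'.
generalize (filter_and _ _ Hf (HM M _ He3)). apply filter_imp.
intros t [[Hft Hgt] Hd].
pose proof (Htail (f t) (g t) Hft Hgt M) as H1.
pose proof (Htail l L Hlu HL M) as H2.
replace (g t - L)%C with ((g t - Cprod (f t) M) + ((Cprod (f t) M - Cprod l M)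
  + - (L - Cprod l M)))%C by ring.
eapply Rle_lt_trans; [apply Cmod_triangle |].
eapply Rle_lt_trans; [apply Rplus_le_compat_l, Cmod_triangle |].
rewrite Cmod_opp. lra.
Qed.

Lemma summable_ext_loc u v : summable u -> (forall k, 0 <= v k) ->
  (exists K, forall k, (K <= k)%nat -> v k <= u k) -> summable v.
Proof.
intros [Hu Hs] Hv [K HK]. split; [exact Hv |].
apply ex_series_incr_n with K.
apply (ex_series_le (V := R_CompleteNormedModule) (fun k => v (S (K + k)))
  (fun k => u (S (K + k)))).
- intros k. unfold norm; simpl. unfold abs; simpl. rewrite Rabs_pos_eq by apply Hv.
  apply HK. lia.
- now apply (ex_series_incr_n (fun k => u (S k)) K).
Qed.

Lemma summable_tends_0 u : summable u -> is_lim_seq u 0.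
Proof.
intros [_ Hs]. apply is_lim_seq_incr_1. now apply ex_series_lim_0.
Qed.

(** The product of the reciprocals converges too, because |1/f - 1| <= 2 |f - 1| as soon as |f - 1|
    < 1/2. The two limits multiply to 1, so neither vanishes. *)
Lemma Cprod_lim_neq_0 f u l : summable u ->
  (forall k, (1 <= k)%nat -> Cmod (f k - 1)%C <= u k) ->
  (forall k, (1 <= k)%nat -> f k <> RtoC 0) ->
  tends eventually (Cprod f) l -> l <> RtoC 0.
Proof.
intros Hu Hf Hf0 Hl.
set (v := fun k => match k with O => 0 | _ => Cmod (/ f k - 1)%C end).
assert (Hv : summable v).
{ apply summable_ext_loc with (u := fun k => 2 * u k).
  - apply summable_scal; [lra | exact Hu].
  - intros [|k]; simpl; [lra | apply Cmod_ge_0].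
  - pose proof (summable_tends_0 u Hu) as H0. apply is_lim_seq_spec in H0.
    assert (Hh : 0 < / 2) by lra.
    destruct (H0 (mkposreal _ Hh)) as [K HK]. exists K. simpl in HK.
    intros [|k] Hk; simpl; [pose proof (proj1 Hu 0%nat); lra |].
    specialize (HK _ Hk). apply Rabs_def2 in HK.
    specialize (Hf (S k) ltac:(lia)). specialize (Hf0 (S k) ltac:(lia)).
    replace (/ f (S k) - 1)%C with (- (f (S k) - 1) / f (S k))%C by (field; exact Hf0).
    rewrite Cmod_div by exact Hf0. rewrite Cmod_opp.
    pose proof (Cmod_triangle (f (S k)) (- (f (S k) - 1))) as Ht.
    replace (f (S k) + - (f (S k) - 1))%C with (RtoC 1) in Ht by ring.
    rewrite Cmod_opp, Cmod_1 in Ht.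
    assert (Hm : / 2 < Cmod (f (S k))) by lra.
    apply Rmult_le_reg_r with (Cmod (f (S k))); [lra |].
    unfold Rdiv. rewrite Rmult_assoc, Rinv_l by lra.
    pose proof (proj1 Hu (S k)). nra. }
assert (Hm : tends eventually (Cprod (fun k => / f k)%C) (Cinfprod (fun k => / f k)%C)).
{ apply (Cprod_tends _ v Hv). intros [|k] Hk; [lia |]. simpl. lra. }
intros E. apply C1_nz.
rewrite <- (Cmult_0_l (Cinfprod (fun k => / f k)%C)), <- E.
apply (tends_unique eventually (fun _ => RtoC 1)); [apply (tends_const eventually) |].
apply (tends_ext eventually (fun N => Cprod f N * Cprod (fun k => / f k) N)%C).
- intros N. rewrite Cprod_inv by exact Hf0. field.
  apply Cprod_neq_0. intros; apply Hf0; lia.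
- now apply (tends_mult eventually).
Qed.

Lemma tends_Cprod {T} F {FF : Filter F} (f : T -> nat -> C) l N :
  (forall k, (1 <= k <= N)%nat -> tends F (fun t => f t k) (l k)) ->
  tends F (fun t => Cprod (f t) N) (Cprod l N).
Proof.
induction N as [|N IH]; intros H; simpl; [apply (tends_const F) |].
apply (tends_mult F); [apply IH; intros; apply H; lia | apply H; lia].
Qed.

Lemma exp_minus_1_le x : exp x - 1 <= x * exp x.
Proof.
pose proof (exp_ineq1_le (- x)) as H. pose proof (exp_pos x) as Hp.
assert (E : exp x * exp (- x) = 1) by (rewrite <- exp_plus, Rplus_opp_r; apply exp_0).
nra.
Qed.

Lemma Rsum_scal c u N : Rsum (fun k => c * u k) N = c * Rsum u N.
Proof. induction N as [|N IH]; simpl; [ring | rewrite IH; ring]. Qed.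

(** A majorant of product form makes the partial products over [n] differ from 1 by at most
    [K * u m], uniformly in their length [N]; the exchange of limits then applies with [N] as
    parameter. *)
Lemma double_Cprod_exchange (a : nat -> nat -> C) (u v : nat -> R) :
  summable u -> summable v ->
  (forall m n, (1 <= m)%nat -> (1 <= n)%nat -> Cmod (a m n - 1)%C <= u m * v n) ->
  exists L, tends eventually (Cprod (fun n => Cinfprod (fun m => a m n))) L /\
            tends eventually (Cprod (fun m => Cinfprod (fun n => a m n))) L.
Proof.
intros Hu Hv Ha.
destruct (summable_lim u Hu) as [U HU]. destruct (summable_lim v Hv) as [V HV].
assert (HA : forall n, (1 <= n)%nat ->
  tends eventually (Cprod (fun m => a m n)) (Cinfprod (fun m => a m n))).
{ intros n Hn. apply Cprod_tends with (u := fun m => v n * u m).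
  - apply summable_scal; [apply Hv | exact Hu].
  - intros m Hm. rewrite Rmult_comm. now apply Ha. }
assert (HB : forall m, (1 <= m)%nat ->
  tends eventually (Cprod (fun n => a m n)) (Cinfprod (fun n => a m n))).
{ intros m Hm. apply Cprod_tends with (u := fun n => u m * v n).
  - apply summable_scal; [apply Hu | exact Hv].
  - intros n Hn. now apply Ha. }
assert (HV0 : 0 <= V) by (apply (Rsum_le_lim v V 0); [apply Hv | exact HV]).
(* From exp(t) - 1 <= t exp(t) at t = [u m * Rsum v N], with t <= [u m * V] in the first factor and
   t <= [U * V] in the exponent. *)
set (K := V * exp (U * V)).
assert (HK : 0 <= K) by (pose proof (exp_pos (U * V)); unfold K; nra).
assert (Hf : forall N m, (1 <= m)%nat ->
  Cmod (Cprod (fun n => a m n) N - 1)%C <= K * u m).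
{ intros N [|m] Hm; [lia |].
  pose proof (Cprod_dist (fun n => a (S m) n) (fun n => u (S m) * v n) 0 N
    ltac:(intros n Hn; now apply Ha)) as Hd.
  simpl in Hd. rewrite exp_0, Rsum_scal in Hd.
  pose proof (Rsum_le_lim v V N (proj1 Hv) HV) as HvN.
  pose proof (Rsum_le_lim u U (S m) (proj1 Hu) HU) as HuN. simpl in HuN.
  pose proof (Rsum_incr u 0 m (proj1 Hu)) as Hum. simpl in Hum.
  pose proof (proj1 Hu (S m)) as Hu0.
  eapply Rle_trans; [exact Hd |]. eapply Rle_trans; [apply exp_minus_1_le |].
  assert (H1 : u (S m) * Rsum v N <= u (S m) * V) by (apply Rmult_le_compat_l; lra).
  assert (H2 : u (S m) * V <= U * V) by (apply Rmult_le_compat_r; lra).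
  assert (H3 : exp (u (S m) * Rsum v N) <= exp (U * V)).
  { destruct (Rle_lt_or_eq_dec _ _ (Rle_trans _ _ _ H1 H2)) as [Hlt | ->];
      [left; now apply exp_increasing | lra]. }
  pose proof (exp_pos (u (S m) * Rsum v N)).
  pose proof (Rsum_incr v 0 N (proj1 Hv)) as HvN0. simpl in HvN0.
  unfold K. replace (V * exp (U * V) * u (S m)) with (u (S m) * V * exp (U * V)) by ring.
  apply Rmult_le_compat; nra. }
pose proof (summable_scal K u HK Hu) as HKu.
assert (HL : tends eventually (Cprod (fun m => Cinfprod (fun n => a m n)))
                   (Cinfprod (fun m => Cinfprod (fun n => a m n)))).
{ apply Cprod_tends with (1 := HKu). intros m Hm.
  apply (tends_Cmod_le eventually (fun N => Cprod (fun n => a m n) N - 1)%C).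
  - apply (tends_minus eventually); [now apply HB | apply (tends_const eventually)].
  - apply filter_forall. intros N. now apply Hf. }
exists (Cinfprod (fun m => Cinfprod (fun n => a m n))). split; [| exact HL].
apply (Cprod_limit_exchange eventually) with (1 := HKu) (4 := HL)
  (f := fun N m => Cprod (fun n => a m n) N).
- apply filter_forall. intros N. split; [intros; now apply Hf |].
  apply (tends_ext eventually (fun M => Cprod (fun n => Cprod (fun m => a m n) M) N));
    [intros M; apply Cprod_exchange |].
  apply (tends_Cprod eventually (fun M n => Cprod (fun m => a m n) M)).
  intros n Hn. now apply HA.
- exact HB.
Qed.

(** * The complex exponential *)

Lemma C_eq (x y : C) : Re x = Re y -> Im x = Im y -> x = y.
Proof. intros. now apply injective_projections. Qed.

Lemma Cexp_plus a b : Cexp (a + b) = (Cexp a * Cexp b)%C.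
Proof.
destruct a as [a1 a2], b as [b1 b2]. unfold Cexp. apply C_eq; simpl;
  rewrite exp_plus, ?cos_plus, ?sin_plus; ring.
Qed.

Lemma Cexp_0 : Cexp 0 = RtoC 1.
Proof. unfold Cexp. apply C_eq; simpl; rewrite exp_0, cos_0, sin_0; ring. Qed.

Lemma Cexp_opp_l a : (Cexp (- a) * Cexp a)%C = RtoC 1.
Proof. rewrite <- Cexp_plus, <- Cexp_0. f_equal. ring. Qed.

Lemma Cexp_neq_0 a : Cexp a <> RtoC 0.
Proof.
intros H. apply C1_nz. rewrite <- (Cexp_opp_l a), H. ring.
Qed.

Lemma Cexp_opp a : Cexp (- a) = (/ Cexp a)%C.
Proof.
rewrite <- (Cmult_1_r (Cexp (- a))), <- (Cinv_r (Cexp a)) by apply Cexp_neq_0.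
rewrite Cmult_assoc, Cexp_opp_l. ring.
Qed.

Lemma Cmod_Cexp a : Cmod (Cexp a) = exp (Re a).
Proof.
unfold Cexp. rewrite Cmod_mult, Cmod_R, Rabs_pos_eq by (left; apply exp_pos).
replace (Cmod (cos (Im a), sin (Im a))) with 1; [ring |].
unfold Cmod. simpl fst. simpl snd.
pose proof (sin2_cos2 (Im a)) as H. unfold Rsqr in H.
replace (cos (Im a) ^ 2 + sin (Im a) ^ 2) with 1 by (simpl; lra). now rewrite sqrt_1.
Qed.

Lemma Cexp_pow a n : (Cexp a ^ n)%C = Cexp (INR n * a).
Proof.
induction n as [|n IH]; [simpl; rewrite <- Cexp_0; f_equal; ring |].
rewrite Cpow_S, IH, <- Cexp_plus. f_equal. rewrite S_INR, RtoC_plus. ring.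
Qed.

(* [cis z] is the paper's [w], and [cis tau] its [q] *)
Definition cis (z : C) : C := Cexp (PI * Ci * z).

Lemma cis_plus a b : cis (a + b) = (cis a * cis b)%C.
Proof. unfold cis. rewrite <- Cexp_plus. f_equal. ring. Qed.

Lemma cis_opp a : cis (- a) = (/ cis a)%C.
Proof. unfold cis. rewrite <- Cexp_opp. f_equal. ring. Qed.

Lemma cis_neq_0 a : cis a <> RtoC 0.
Proof. apply Cexp_neq_0. Qed.

Lemma cis_half : cis (1 / 2) = Ci.
Proof.
unfold cis. replace (PI * Ci * (1 / 2))%C with (0, PI / 2).
- unfold Cexp. apply C_eq; simpl; rewrite exp_0, cos_PI2, sin_PI2; ring.
- rewrite <- RtoC_div by lra. apply C_eq; simpl; field.
Qed.

Lemma Ci_sqr : (Ci * Ci)%C = (- (1))%C.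
Proof. apply C_eq; simpl; ring. Qed.

Lemma C2_nz : RtoC 2 <> RtoC 0.
Proof. intros H. apply RtoC_inj in H. lra. Qed.

Lemma Ci_nz : Ci <> RtoC 0.
Proof. intros H. injection H. lra. Qed.

Lemma cis_1 : cis 1 = (- (1))%C.
Proof.
transitivity (cis (1 / 2 + 1 / 2)); [f_equal; field; exact C2_nz |].
now rewrite cis_plus, cis_half, Ci_sqr.
Qed.

Lemma cis_pow a n : (cis a ^ n)%C = cis (INR n * a).
Proof. unfold cis. rewrite Cexp_pow. f_equal. ring. Qed.

Lemma Cmod_cis a : Cmod (cis a) = exp (- PI * Im a).
Proof. unfold cis. rewrite Cmod_Cexp. f_equal. destruct a; simpl. ring. Qed.

(** Taking moduli forces [Im x = 0]; the real part then reads 1 - 2 sin(PI a)^2 = 1 with a = [Re x],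
    and the zeros of the sine are known. *)
Lemma cis_mult_self_eq_1 (x : C) : (cis x * cis x)%C = RtoC 1 -> exists k : Z, x = RtoC (IZR k).
Proof.
rewrite <- cis_plus. intros H.
pose proof PI_RGT_0 as HPI.
assert (Hm : exp (- PI * Im (x + x)) = exp 0).
{ rewrite <- Cmod_cis, H, Cmod_1, exp_0. reflexivity. }
apply exp_inv in Hm. destruct x as [a b]. simpl in Hm.
assert (Hb : b = 0) by nra. subst b.
assert (Hs : sin (PI * a) = 0).
{ apply (f_equal Re) in H. unfold cis, Cexp in H. simpl in H.
  match type of H with context [exp ?e] => replace e with 0 in H by ring end.
  match type of H with context [cos ?e] => replace e with (2 * (PI * a)) in H by ring end.
  rewrite exp_0, cos_2a_sin in H. nra. }
destruct (sin_eq_0_0 _ Hs) as [k Hk]. exists k.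
apply C_eq; simpl; [| reflexivity]. nra.
Qed.

Lemma filterlim_tends {T} F {FF : Filter F} (f : T -> C) (l : C) :
  filterlim (fun t => Re (f t)) F (locally (Re l)) ->
  filterlim (fun t => Im (f t)) F (locally (Im l)) -> tends F f l.
Proof.
intros H1 H2 eps He. assert (He2 : 0 < eps / 2) by lra.
generalize (filter_and _ _ (proj1 (filterlim_locally _ _) H1 (mkposreal _ He2))
                           (proj1 (filterlim_locally _ _) H2 (mkposreal _ He2))).
apply filter_imp. intros t [B1 B2].
change (Rabs (Re (f t) - Re l) < eps / 2) in B1.
change (Rabs (Im (f t) - Im l) < eps / 2) in B2.
eapply Rle_lt_trans; [apply Cmod_2Rmax |].
assert (Hmax : Rmax (Rabs (fst (f t - l)%C)) (Rabs (snd (f t - l)%C)) < eps / 2)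
  by now apply Rmax_lub_lt.
assert (sqrt 2 <= 2) by (apply Rsqr_incr_0_var; unfold Rsqr; [rewrite sqrt_sqrt |]; lra).
pose proof (Rmax_l (Rabs (fst (f t - l)%C)) (Rabs (snd (f t - l)%C))).
pose proof (Rabs_pos (fst (f t - l)%C)). pose proof (sqrt_pos 2). nra.
Qed.

Lemma tends_Re {T} F {FF : Filter F} (f : T -> C) (l : C) :
  tends F f l -> filterlim (fun t => Re (f t)) F (locally (Re l)).
Proof.
intros H. apply filterlim_locally. intros [eps He].
generalize (H eps He). apply filter_imp. intros t Ht.
change (Rabs (Re (f t - l)%C) < eps).
eapply Rle_lt_trans; [apply re_le_Cmod | exact Ht].
Qed.

(** Rotation by [- Ci] carries facts about real parts over to imaginary parts. *)
Lemma Im_Re (z : C) : Im z = Re (- Ci * z)%C.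
Proof. destruct z; simpl; ring. Qed.

Lemma tends_Im {T} F {FF : Filter F} (f : T -> C) (l : C) :
  tends F f l -> filterlim (fun t => Im (f t)) F (locally (Im l)).
Proof.
intros H. rewrite Im_Re.
apply (filterlim_ext (fun t => Re (- Ci * f t)%C)); [intros; now rewrite <- Im_Re |].
apply (tends_Re F). apply (tends_mult F); [apply (tends_const F) | exact H].
Qed.

Lemma tends_Cexp {T} F {FF : Filter F} (f : T -> C) (l : C) :
  tends F f l -> tends F (fun t => Cexp (f t)) (Cexp l).
Proof.
intros H. pose proof (tends_Re F f l H) as HR. pose proof (tends_Im F f l H) as HI.
assert (Hexp : filterlim (fun t => exp (Re (f t))) F (locally (exp (Re l)))).
{ apply (filterlim_comp _ _ _ _ exp _ (locally (Re l))); [exact HR |].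
  apply continuity_pt_filterlim, derivable_continuous_pt, derivable_pt_exp. }
assert (Hcos : filterlim (fun t => cos (Im (f t))) F (locally (cos (Im l)))).
{ apply (filterlim_comp _ _ _ _ cos _ (locally (Im l))); [exact HI |].
  apply continuity_pt_filterlim, continuity_cos. }
assert (Hsin : filterlim (fun t => sin (Im (f t))) F (locally (sin (Im l)))).
{ apply (filterlim_comp _ _ _ _ sin _ (locally (Im l))); [exact HI |].
  apply continuity_pt_filterlim, continuity_sin. }
apply (filterlim_tends F).
- replace (Re (Cexp l)) with (exp (Re l) * cos (Im l)) by (simpl; ring).
  apply (filterlim_ext (fun t => exp (Re (f t)) * cos (Im (f t)))); [intros; simpl; ring |].
  eapply filterlim_comp_2; [exact Hexp | exact Hcos |].
  exact (filterlim_mult (K := R_AbsRing) (exp (Re l)) (cos (Im l))).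
- replace (Im (Cexp l)) with (exp (Re l) * sin (Im l)) by (simpl; ring).
  apply (filterlim_ext (fun t => exp (Re (f t)) * sin (Im (f t)))); [intros; simpl; ring |].
  eapply filterlim_comp_2; [exact Hexp | exact Hsin |].
  exact (filterlim_mult (K := R_AbsRing) (exp (Re l)) (sin (Im l))).
Qed.

Lemma tends_cis {T} F {FF : Filter F} (f : T -> C) (l : C) :
  tends F f l -> tends F (fun t => cis (f t)) (cis l).
Proof.
intros H. apply (tends_Cexp F), (tends_mult F); [apply (tends_const F) | exact H].
Qed.

Lemma INR_C_nz n : RtoC (INR (S n)) <> RtoC 0.
Proof. intros H. apply RtoC_inj in H. now apply (not_0_INR (S n)). Qed.

Lemma is_derive_slope (f : R -> R) (l : R) : is_derive f 0 l ->
  is_lim_seq (fun n => INR (S n) * (f (/ INR (S n)) - f 0)) l.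
Proof.
intros Hd. apply is_derive_Reals in Hd. apply is_lim_seq_spec. intros eps.
destruct (Hd eps (cond_pos eps)) as [d Hd'].
destruct (tends_inv_INR d (cond_pos d)) as [N HN]. exists N. intros n Hn.
specialize (HN n Hn). rewrite <- RtoC_minus, Cmod_R, Rminus_0_r in HN.
assert (HS : INR (S n) <> 0) by now apply not_0_INR.
specialize (Hd' (/ INR (S n)) (Rinv_neq_0_compat _ HS) HN).
rewrite Rplus_0_l in Hd'.
replace (INR (S n) * (f (/ INR (S n)) - f 0)) with ((f (/ INR (S n)) - f 0) / / INR (S n))
  by (field; exact HS). exact Hd'.
Qed.

(** The derivative at 0 of t -> exp(t x) along t = 1/(n + 1), computed as two real derivatives, one
    per coordinate. *)
Lemma tends_Cexp_slope (x : C) :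
  tends eventually (fun n => RtoC (INR (S n)) * (Cexp (x / RtoC (INR (S n))) - 1))%C x.
Proof.
destruct x as [a b].
assert (E : forall n, ((a, b) / RtoC (INR (S n)))%C = (a * / INR (S n), b * / INR (S n))).
{ intros n. unfold Cdiv. rewrite <- RtoC_inv by now apply not_0_INR.
  apply C_eq; simpl; ring. }
apply (filterlim_tends eventually).
- refine (is_lim_seq_ext (fun n => INR (S n) *
    ((fun t => exp (a * t) * cos (b * t)) (/ INR (S n)) -
     (fun t => exp (a * t) * cos (b * t)) 0)) _ (Finite a) _ _).
  + intros n. rewrite E. generalize (INR (S n)) as N. intros N. unfold Cexp. simpl.
    rewrite !Rmult_0_r, exp_0, cos_0. ring.
  + apply (is_derive_slope (fun t => exp (a * t) * cos (b * t)) a). auto_derive; [trivial |].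
    rewrite !Rmult_0_r, exp_0, cos_0, sin_0. simpl. ring.
- refine (is_lim_seq_ext (fun n => INR (S n) *
    ((fun t => exp (a * t) * sin (b * t)) (/ INR (S n)) -
     (fun t => exp (a * t) * sin (b * t)) 0)) _ (Finite b) _ _).
  + intros n. rewrite E. generalize (INR (S n)) as N. intros N. unfold Cexp. simpl.
    rewrite !Rmult_0_r, exp_0, sin_0. ring.
  + apply (is_derive_slope (fun t => exp (a * t) * sin (b * t)) b). auto_derive; [trivial |].
    rewrite !Rmult_0_r, exp_0, cos_0, sin_0. simpl. ring.
Qed.

(** * The product for the sine *)

(* [csin z] is [2 i sin (PI z)]. *)
Definition csin (z : C) : C := (cis z - cis (- z))%C.

(** The cosine is written as a shifted sine, so that the formula can be applied again to each of its
    factors. *)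
Lemma csin_double y : csin (2 * y) = (- Ci * csin y * csin (y + 1 / 2))%C.
Proof.
unfold csin.
replace (2 * y)%C with (y + y)%C by ring.
replace (- (y + 1 / 2))%C with (- y + - (1 / 2))%C by ring.
replace (- (y + y))%C with (- y + - y)%C by ring.
rewrite !cis_plus, (cis_opp (1 / 2)), cis_half, Ci_inv.
replace (- Ci * (cis y - cis (- y)) * (cis y * Ci - cis (- y) * - Ci))%C
  with (- (Ci * Ci) * (cis y * cis y - cis (- y) * cis (- y)))%C by ring.
rewrite Ci_sqr. ring.
Qed.

Lemma csin_opp y : csin (- y) = (- csin y)%C.
Proof. unfold csin. replace (- - y)%C with y by ring. ring. Qed.

Lemma csin_plus_1 y : csin (y + 1) = (- csin y)%C.
Proof.
unfold csin. replace (- (y + 1))%C with (- y + - (1))%C by ring.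
rewrite !cis_plus, (cis_opp 1), cis_1. field.
Qed.

Lemma csin_mult a b :
  (csin (a + b) * csin (a - b))%C = (csin a * csin a - csin b * csin b)%C.
Proof.
unfold csin, Cminus.
replace (- (a + b))%C with (- a + - b)%C by ring.
replace (- (a + - b))%C with (- a + b)%C by ring.
rewrite !cis_plus, !cis_opp. field. split; apply cis_neq_0.
Qed.

Lemma csin_real (r : R) : csin (RtoC r) = (2 * Ci * sin (PI * r))%C.
Proof.
unfold csin, cis.
replace (PI * Ci * r)%C with (0, PI * r) by (apply C_eq; simpl; ring).
replace (PI * Ci * - r)%C with (0, - (PI * r)) by (apply C_eq; simpl; ring).
unfold Cexp. apply C_eq; simpl; rewrite exp_0, cos_neg, sin_neg; ring.
Qed.

(** The last [m] factors are read backwards, so that node [S N - k] stands next to node [k]. *)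
Lemma Cprod_reflect (f : nat -> C) N m : (m <= N)%nat ->
  (Cprod f (N - m) * Cprod (fun k => f (S N - k)%nat) m)%C = Cprod f N.
Proof.
induction m as [|m IH]; intros Hm; [rewrite Nat.sub_0_r; simpl; ring |].
rewrite <- IH by lia. replace (N - m)%nat with (S (N - S m)) by lia.
simpl Cprod. replace (S N - S m)%nat with (S (N - S m)) by lia.
replace (S (N - S m)) with (N - m)%nat by lia. ring.
Qed.

Definition C2pow (j : nat) : C := RtoC (INR (2 ^ j)).

Lemma C2pow_S j : C2pow (S j) = (2 * C2pow j)%C.
Proof. unfold C2pow. rewrite Nat.pow_succ_r', mult_INR, RtoC_mult. reflexivity. Qed.

Lemma pow2_pos j : (1 <= 2 ^ j)%nat.
Proof. induction j; simpl; lia. Qed.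

Lemma C2pow_nz j : C2pow j <> RtoC 0.
Proof.
intros H. apply RtoC_inj in H. revert H. apply not_0_INR. pose proof (pow2_pos j). lia.
Qed.

(* Euler: iterate the duplication formula, pairing the nodes [k] and [- k]. *)
Lemma csin_factor j (x : C) :
  csin x = (- Ci * csin (x / C2pow (S j)) * csin ((x + C2pow j) / C2pow (S j)) *
    Cprod (fun k => csin ((x + INR k) / C2pow (S j)) * csin ((x - INR k) / C2pow (S j)))
      (2 ^ j - 1))%C.
Proof.
induction j as [|j IH].
- simpl Cprod. rewrite C2pow_S. unfold C2pow. simpl INR.
  replace x with (2 * (x / 2))%C at 1 by (field; exact C2_nz).
  rewrite csin_double.
  replace (x / 2 + 1 / 2)%C with ((x + 1) / (2 * 1))%C by (field; exact C2_nz).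
  replace (x / 2)%C with (x / (2 * 1))%C by (field; exact C2_nz). ring.
- set (h := (2 ^ j)%nat) in *. set (n' := C2pow (S (S j))). set (n := C2pow (S j)) in *.
  assert (Hn' : n' = (2 * n)%C) by apply C2pow_S.
  assert (Hn : n = (2 * C2pow j)%C) by apply C2pow_S.
  assert (Hn0 : n <> RtoC 0) by apply C2pow_nz.
  assert (Hh0 : C2pow j <> RtoC 0) by apply C2pow_nz.
  assert (Hdup : forall y, csin (y / n) = (- Ci * csin (y / n') * csin ((y + n) / n'))%C).
  { intros y. replace (y / n)%C with (2 * (y / n'))%C
      by (rewrite Hn'; field; exact Hn0).
    rewrite csin_double. do 2 f_equal. rewrite Hn'. field. exact Hn0. }
  assert (Hper : forall y, csin ((y + n + n) / n') = (- csin (y / n'))%C).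
  { intros y. rewrite <- csin_plus_1. f_equal. rewrite Hn'. field. exact Hn0. }
  set (f := fun k => (csin ((x + INR k) / n') * csin ((x - INR k) / n'))%C).
  replace (2 ^ S j - 1)%nat with (2 * h - 1)%nat by (simpl; fold h; lia).
  assert (Hh : (1 <= h)%nat) by apply pow2_pos.
  (* The nodes 1, ..., 2h - 1 are the k < h, the middle h and the mirror images 2h - k. Duplicating
     the factors of the old node k gives those of k and 2h - k; the node h comes from duplicating
     the unpaired [csin ((x + C2pow j) / n)]. *)
  rewrite <- (Cprod_reflect f (2 * h - 1) (h - 1)) by lia.
  replace (2 * h - 1 - (h - 1))%nat with (S (h - 1)) by lia.
  change (Cprod f (S (h - 1))) with (Cprod f (h - 1) * f (S (h - 1)))%C.
  replace (S (h - 1)) with h by lia.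
  rewrite IH, (Cprod_ext _ (fun k => f k * f (S (2 * h - 1) - k)%nat)%C), Cprod_mult.
  + rewrite (Hdup x), (Hdup (x + C2pow j)%C).
    replace (csin ((x + C2pow j + n) / n')) with (- csin ((x - C2pow j) / n'))%C.
    2:{ rewrite <- Hper. do 2 f_equal. rewrite Hn. ring. }
    change (f h) with (csin ((x + C2pow j) / n') * csin ((x - C2pow j) / n'))%C.
    ring_simplify. replace (Ci ^ 3)%C with (- Ci)%C; [ring |].
    replace (Ci ^ 3)%C with (Ci * Ci * Ci)%C by ring. rewrite Ci_sqr. ring.
  + intros k Hk. unfold f. rewrite (Hdup (x + INR k)%C), (Hdup (x - INR k)%C).
    assert (Hkn : RtoC (INR (S (2 * h - 1) - k)) = (n - INR k)%C).
    { rewrite Hn. replace (S (2 * h - 1) - k)%nat with (2 * h - k)%nat by lia.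
      rewrite minus_INR, mult_INR by lia. rewrite RtoC_minus, RtoC_mult. reflexivity. }
    rewrite Hkn.
    replace (csin ((x + INR k + n) / n')) with (- csin ((x - (n - INR k)) / n'))%C.
    2:{ rewrite <- Hper. do 2 f_equal. ring. }
    replace (x - INR k + n)%C with (x + (n - INR k))%C by ring.
    ring_simplify. replace (Ci ^ 2)%C with (- (1))%C; [ring |].
    rewrite <- Ci_sqr. ring.
Qed.

Lemma csin_plus_half_tends (x : C) :
  tends eventually (fun n => csin (x / RtoC (INR (S n)) + 1 / 2)) (2 * Ci)%C.
Proof.
assert (H0 : tends eventually (fun n => x / RtoC (INR (S n)))%C 0).
{ apply (tends_ext eventually (fun n => x * RtoC (/ INR (S n)))%C).
  - intros n. rewrite RtoC_inv by now apply not_0_INR. reflexivity.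
  - rewrite <- (Cmult_0_r x). apply (tends_mult eventually);
      [apply (tends_const eventually) | apply tends_inv_INR]. }
unfold csin.
replace (2 * Ci)%C with (cis (0 + 1 / 2) - cis (- (0 + 1 / 2)))%C.
2:{ rewrite Cplus_0_l, cis_opp, cis_half, Ci_inv. ring. }
apply (tends_minus eventually); apply (tends_cis eventually).
- apply (tends_plus eventually); [exact H0 | apply (tends_const eventually)].
- apply (tends_opp eventually), (tends_plus eventually); [exact H0 | apply (tends_const eventually)].
Qed.

Lemma csin_slope (x : C) :
  tends eventually (fun n => RtoC (INR (S n)) * csin (x / RtoC (INR (S n))))%C (2 * PI * Ci * x)%C.
Proof.
pose proof (tends_minus eventually _ _ _ _ (tends_Cexp_slope (PI * Ci * x))
  (tends_Cexp_slope (- (PI * Ci * x)))) as H.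
replace (2 * PI * Ci * x)%C with (PI * Ci * x - - (PI * Ci * x))%C by ring.
apply (tends_ext eventually) with (2 := H). intros n. unfold csin, cis.
replace (PI * Ci * (x / INR (S n)))%C with (PI * Ci * x / INR (S n))%C
  by (field; apply INR_C_nz).
replace (PI * Ci * - (x / INR (S n)))%C with (- (PI * Ci * x) / INR (S n))%C
  by (field; apply INR_C_nz).
ring.
Qed.

(** A crude Jordan inequality from the Taylor polynomial of degree 7. The interval [[0, 2]] contains
    [[0, PI / 2]] because [PI <= 4]. *)
Lemma sin_ge_third t : 0 <= t <= 2 -> t / 3 <= sin t.
Proof.
intros Ht. pose proof PI2_3_2 as HPI.
assert (HPI' : t <= PI) by lra.
destruct (SIN t (proj1 Ht) HPI') as [H _]. eapply Rle_trans; [| exact H].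
unfold sin_lb, sin_approx, sum_f_R0, sin_term. simpl.
match goal with |- _ <= ?r =>
  replace r with (t - t ^ 3 / 6 + t ^ 5 / 120 - t ^ 7 / 5040) by (simpl; field) end.
set (y := t * t). assert (Hy : 0 <= y <= 4) by (unfold y; nra).
replace (t - t ^ 3 / 6 + t ^ 5 / 120 - t ^ 7 / 5040)
  with (t * (1 - y / 6 + y * y * (42 - y) / 5040)) by (unfold y; field).
assert (0 <= y * y * (42 - y)) by (apply Rmult_le_pos; nra).
nra.
Qed.

(** Linear growth in [k] of the denominators in Euler's product, so that their inverse squares are
    summable. The 3 lost in [sin_ge_third] is regained from [PI > 3]. *)
Lemma Cmod_csin_real_ge (k h : nat) : (k <= h)%nat -> (1 <= h)%nat ->
  2 * INR k / INR (2 * h) <= Cmod (csin (INR k / INR (2 * h))).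
Proof.
intros Hk Hh.
assert (Hh0 : 1 <= INR h) by (apply (le_INR 1); exact Hh).
assert (Hk0 : 0 <= INR k <= INR h) by (split; [apply pos_INR | now apply le_INR]).
rewrite mult_INR. simpl (INR 2).
rewrite <- RtoC_div by lra. rewrite csin_real, !Cmod_mult, Cmod_Ci, !Cmod_R, (Rabs_pos_eq 2) by lra.
assert (Hr : INR k / ((1 + 1) * INR h) * INR h = INR k / 2) by (field; lra).
set (r := INR k / ((1 + 1) * INR h)) in *.
assert (Hr2 : 0 <= r <= / 2) by (split; nra).
pose proof PI2_3_2 as HPI. pose proof PI_4 as HPI4.
pose proof (sin_ge_third (PI * r) ltac:(split; nra)) as Hs.
rewrite Rabs_pos_eq by nra.
replace (2 * INR k / ((1 + 1) * INR h)) with (2 * r) by (unfold r; field; lra). nra.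
Qed.

(** Padding with 1 turns products whose length grows with [j] into infinite products, so that one
    majorant can serve for all large [j]. *)
Definition csin_ratio (j : nat) (x : C) (k : nat) : C :=
  if (k <? 2 ^ j)%nat
  then (1 - (csin (x / C2pow (S j)) / csin (INR k / C2pow (S j))) ^ 2)%C else 1.

Lemma csin_node_neq_0 j k : (1 <= k < 2 ^ j)%nat -> csin (INR k / C2pow (S j)) <> RtoC 0.
Proof.
intros Hk. apply Cmod_gt_0. eapply Rlt_le_trans.
2:{ apply (Cmod_csin_real_ge k (2 ^ j)); [lia | apply pow2_pos]. }
apply Rdiv_lt_0_compat; [| apply lt_0_INR; pose proof (pow2_pos j); lia].
apply Rmult_lt_0_compat; [lra | apply lt_0_INR; lia].
Qed.

(** Since sin(a + b) sin(a - b) = sin(a)^2 - sin(b)^2, each pair of nodes splits into a factor free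
    of [x], collected in [c], and a factor that is 1 at x = 0. *)
Lemma csin_ratio_factor j : exists c, forall x,
  csin x = (c * csin (x / C2pow (S j)) * csin (x / C2pow (S j) + 1 / 2) *
            Cprod (csin_ratio j x) (2 ^ j - 1))%C.
Proof.
exists (- Ci * Cprod (fun k => - csin (INR k / C2pow (S j)) ^ 2) (2 ^ j - 1))%C.
intros x. rewrite (csin_factor j x) at 1.
rewrite (Cprod_ext _ (fun k => - csin (INR k / C2pow (S j)) ^ 2 * csin_ratio j x k)%C).
- rewrite Cprod_mult.
  replace ((x + C2pow j) / C2pow (S j))%C with (x / C2pow (S j) + 1 / 2)%C; [ring |].
  rewrite C2pow_S. field. apply C2pow_nz.
- intros k Hk. unfold csin_ratio.
  replace (k <? 2 ^ j)%nat with true by (symmetry; apply Nat.ltb_lt; lia).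
  replace ((x + INR k) / C2pow (S j))%C with (x / C2pow (S j) + INR k / C2pow (S j))%C
    by (field; apply C2pow_nz).
  replace ((x - INR k) / C2pow (S j))%C with (x / C2pow (S j) - INR k / C2pow (S j))%C
    by (field; apply C2pow_nz).
  rewrite csin_mult. field. apply csin_node_neq_0. lia.
Qed.

Lemma summable_inv_sqr : summable (fun k => / (INR k * INR k)).
Proof.
split.
- intros [|k]; [simpl; rewrite Rmult_0_l, Rinv_0; lra |].
  left. apply Rinv_0_lt_compat. apply Rmult_lt_0_compat; apply lt_0_INR; lia.
(* The differences 1/(k+1) - 1/(k+2) telescope to 1 and dominate 1/(k+2)^2, hence the additional
   shift by one index below. *)
- set (v := fun k => / INR (S k)).
  assert (Hv : ex_series (fun k => v k - v (S k))).
  { exists 1. change (is_lim_seq (sum_n (fun k => v k - v (S k))) 1).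
    apply (is_lim_seq_ext (fun n => 1 - / INR (S (S n)))).
    - intros n. induction n as [|n IH].
      + rewrite sum_O. unfold v. simpl. lra.
      + rewrite sum_Sn, <- IH. unfold plus; simpl plus. unfold v. cbn -[INR]. ring.
    - replace (Finite 1) with (Finite (1 - 0)) by (f_equal; ring).
      apply is_lim_seq_minus'; [apply is_lim_seq_const |].
      apply (is_lim_seq_incr_1 (fun n => / INR (S n))), (is_lim_seq_incr_1 (fun n => / INR n)).
      replace (Finite 0) with (Rbar_inv p_infty) by reflexivity.
      apply is_lim_seq_inv; [apply is_lim_seq_INR | discriminate]. }
  apply (ex_series_incr_1 (fun k => / (INR (S k) * INR (S k)))).
  apply (ex_series_le (V := R_CompleteNormedModule) _ (fun k => v k - v (S k))); [| exact Hv].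
  intros k. unfold norm; simpl norm. unfold abs; simpl abs. unfold v.
  rewrite (S_INR (S k)).
  assert (H1 : 1 <= INR (S k)) by (apply (le_INR 1); lia).
  rewrite Rabs_pos_eq by (left; apply Rinv_0_lt_compat; nra).
  replace (/ INR (S k) - / (INR (S k) + 1)) with (/ (INR (S k) * (INR (S k) + 1))) by (field; lra).
  apply Rinv_le_contravar; nra.
Qed.

Definition sine_factor (x : C) (k : nat) : C := (1 - x ^ 2 / INR k ^ 2)%C.

Lemma sine_factor_bound x k : (1 <= k)%nat ->
  Cmod (sine_factor x k - 1)%C <= Cmod x ^ 2 * / (INR k * INR k).
Proof.
intros Hk. destruct k as [|k]; [lia |]. unfold sine_factor.
replace (1 - x ^ 2 / INR (S k) ^ 2 - 1)%C with (- (x ^ 2 / INR (S k) ^ 2))%C by ring.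
rewrite Cmod_opp, Cmod_div, !Cmod_pow, Cmod_R, Rabs_pos_eq
  by (try apply pos_INR; apply Cpow_nz, INR_C_nz).
right. simpl pow. rewrite !Rmult_1_r. reflexivity.
Qed.

Lemma sine_factor_tends x :
  tends eventually (Cprod (sine_factor x)) (Cinfprod (sine_factor x)).
Proof.
apply Cprod_tends with (u := fun k => Cmod x ^ 2 * / (INR k * INR k)).
- apply summable_scal; [apply pow_le, Cmod_ge_0 | apply summable_inv_sqr].
- apply sine_factor_bound.
Qed.

Lemma tends_C2pow (f : C -> C) l :
  tends eventually (fun n => f (RtoC (INR (S n)))) l ->
  tends eventually (fun j => f (C2pow (S j))) l.
Proof.
intros H. apply (tends_ext eventually (fun j => f (INR (S (2 ^ S j - 1))))).
- intros j. unfold C2pow. do 3 f_equal. pose proof (pow2_pos (S j)). lia.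
- apply (tends_subseq (fun j => (2 ^ S j - 1)%nat) (fun n => f (INR (S n)))); [| exact H].
  intros j. pose proof (Nat.pow_gt_lin_r 2 (S j) ltac:(lia)). lia.
Qed.

Lemma csin_ratio_tends (x : C) :
  tends eventually (fun j => Cprod (csin_ratio j x) (2 ^ j - 1)) (Cinfprod (sine_factor x)).
Proof.
(* With n = [C2pow (S j)], the modulus of n csin(x/n) tends to 2 PI |x|, so it is eventually below
   [X]. As |csin(k/n)| >= k/n, the squared ratio is then at most X^2/k^2, uniformly in [j]. *)
set (X := 2 * PI * Cmod x + 1).
assert (Hsl : tends eventually (fun j => C2pow (S j) * csin (x / C2pow (S j)))%C (2 * PI * Ci * x)%C).
{ apply (tends_C2pow (fun n => n * csin (x / n))%C), csin_slope. }
apply (Cprod_limit_exchange eventually (fun j k => csin_ratio j x k)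
  (fun k => X ^ 2 * / (INR k * INR k)) (sine_factor x)).
- apply summable_scal; [apply pow2_ge_0 | apply summable_inv_sqr].
- generalize (Hsl 1 ltac:(lra)). apply filter_imp. intros j Hj. split.
  + intros k Hk. unfold csin_ratio. destruct (Nat.ltb_spec k (2 ^ j)) as [Hlt | Hge].
    * set (s := csin (x / C2pow (S j))) in *. set (t := csin (INR k / C2pow (S j))).
      assert (Ht : t <> RtoC 0) by (apply csin_node_neq_0; lia).
      replace (1 - (s / t) ^ 2 - 1)%C with (- (s / t) ^ 2)%C by ring.
      rewrite Cmod_opp, Cmod_pow, Cmod_div by exact Ht.
      assert (Hn : 0 < INR (2 * 2 ^ j)) by (apply lt_0_INR; pose proof (pow2_pos j); lia).
      assert (Hk0 : 1 <= INR k) by (apply (le_INR 1); lia).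
      assert (Hs : Cmod s <= X / INR (2 * 2 ^ j)).
      { apply Rmult_le_reg_l with (1 := Hn).
        replace (INR (2 * 2 ^ j) * (X / INR (2 * 2 ^ j))) with X by (field; lra).
        pose proof (Cmod_triangle (C2pow (S j) * s - 2 * PI * Ci * x) (2 * PI * Ci * x)) as Htr.
        replace (C2pow (S j) * s - 2 * PI * Ci * x + 2 * PI * Ci * x)%C
          with (C2pow (S j) * s)%C in Htr by ring.
        rewrite !Cmod_mult, Cmod_Ci, !Cmod_R, (Rabs_pos_eq 2), (Rabs_pos_eq PI) in Htr
          by (pose proof PI_RGT_0; lra).
        unfold C2pow in Htr at 1. rewrite Cmod_R, Rabs_pos_eq in Htr by apply pos_INR.
        change (2 ^ S j)%nat with (2 * 2 ^ j)%nat in Htr. unfold X. lra. }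
      pose proof (Cmod_csin_real_ge k (2 ^ j) ltac:(lia) (pow2_pos j)) as Hlow.
      change (csin (INR k / INR (2 * 2 ^ j))) with t in Hlow.
      assert (Htk : INR k / INR (2 * 2 ^ j) <= Cmod t).
      { eapply Rle_trans; [| exact Hlow]. unfold Rdiv.
        apply Rmult_le_compat_r; [left; now apply Rinv_0_lt_compat | lra]. }
      assert (Hq : Cmod s / Cmod t <= X / INR k).
      { assert (Ht0 : 0 < Cmod t) by now apply Cmod_gt_0.
        apply Rmult_le_reg_r with (Cmod t); [exact Ht0 |].
        unfold Rdiv at 1. rewrite Rmult_assoc, Rinv_l, Rmult_1_r by lra.
        apply Rle_trans with (1 := Hs).
        replace (X / INR (2 * 2 ^ j)) with (X / INR k * (INR k / INR (2 * 2 ^ j))) by (field; lra).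
        apply Rmult_le_compat_l; [| exact Htk].
        apply Rdiv_le_0_compat; [| lra]. unfold X.
        pose proof (Cmod_ge_0 x). pose proof PI_RGT_0. nra. }
      replace (X ^ 2 * / (INR k * INR k)) with ((X / INR k) ^ 2) by (field; lra).
      apply pow_incr. split; [| exact Hq].
      apply Rdiv_le_0_compat; [apply Cmod_ge_0 | now apply Cmod_gt_0].
    * replace (RtoC 1 - 1)%C with (RtoC 0) by ring. rewrite Cmod_0.
      apply Rmult_le_pos; [apply pow2_ge_0 | apply summable_inv_sqr].
  + apply (tends_ext_loc eventually (fun _ => Cprod (csin_ratio j x) (2 ^ j - 1)));
      [| apply (tends_const eventually)].
    exists (2 ^ j - 1)%nat. intros M HM.
    change (Cprod (csin_ratio j x) (2 ^ j - 1) = Cprod (csin_ratio j x) M).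
    induction HM as [|M HM IH]; [reflexivity |].
    transitivity (Cprod (csin_ratio j x) M * csin_ratio j x (S M))%C; [| reflexivity].
    rewrite <- IH. unfold csin_ratio at 3.
    replace (S M <? 2 ^ j)%nat with false by (symmetry; apply Nat.ltb_ge; lia). ring.
- intros k Hk. assert (Hk0 : RtoC (INR k) <> RtoC 0)
    by (destruct k; [lia | apply INR_C_nz]).
  assert (H2pi : (2 * PI * Ci)%C <> RtoC 0).
  { repeat apply Cmult_neq_0; [exact C2_nz | | exact Ci_nz].
    intros H. apply RtoC_inj in H. pose proof PI_RGT_0. lra. }
  assert (Hslk : tends eventually (fun j => C2pow (S j) * csin (INR k / C2pow (S j)))%C
                   (2 * PI * Ci * INR k)%C).
  { apply (tends_C2pow (fun n => n * csin (INR k / n))%C), csin_slope. }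
  apply (tends_ext_loc eventually (fun j => 1 -
    ((C2pow (S j) * csin (x / C2pow (S j))) / (C2pow (S j) * csin (INR k / C2pow (S j)))) *
    ((C2pow (S j) * csin (x / C2pow (S j))) / (C2pow (S j) * csin (INR k / C2pow (S j)))))%C).
  + exists k. intros j Hj. unfold csin_ratio.
    assert (Hkj : (k < 2 ^ j)%nat) by (apply Nat.le_lt_trans with (1 := Hj), Nat.pow_gt_lin_r; lia).
    replace (k <? 2 ^ j)%nat with true by (symmetry; now apply Nat.ltb_lt).
    field. split; [apply csin_node_neq_0; lia | apply C2pow_nz].
  + replace (sine_factor x k) with (1 - (2 * PI * Ci * x) / (2 * PI * Ci * INR k) *
      ((2 * PI * Ci * x) / (2 * PI * Ci * INR k)))%C.
    2:{ unfold sine_factor. field. repeat split; try assumption; try exact Ci_nz.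
        intros H. apply RtoC_inj in H. pose proof PI_RGT_0. lra. }
    apply (tends_minus eventually); [apply (tends_const eventually) |].
    apply (tends_mult eventually); apply (tends_div eventually); try assumption;
      now apply Cmult_neq_0.
- apply sine_factor_tends.
Qed.

(** [kappa] is 1/(2 PI i), but it is kept in the form that comparison with x = 1/2 gives; it cancels
    from every relation between values of [theta]. *)
Lemma csin_product : exists kappa : C, kappa <> RtoC 0 /\ forall x,
  tends eventually (fun M => x * Cprod (sine_factor x) M)%C (kappa * csin x).
Proof.
assert (Hcs : csin (1 / 2) = (2 * Ci)%C) by (unfold csin; rewrite cis_opp, cis_half, Ci_inv; ring).
exists (Cinfprod (sine_factor (1 / 2)) / (4 * Ci))%C. split.
- intros H. apply (Cprod_lim_neq_0 (sine_factor (1 / 2))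
    (fun k => Cmod (1 / 2) ^ 2 * / (INR k * INR k)) (Cinfprod (sine_factor (1 / 2)))).
  + apply summable_scal; [apply pow_le, Cmod_ge_0 | apply summable_inv_sqr].
  + apply sine_factor_bound.
  + intros k Hk H0. unfold sine_factor in H0.
    assert (Hk1 : 1 <= INR k) by (apply (le_INR 1); lia).
    assert (Hk0 : RtoC (INR k) <> RtoC 0) by (destruct k; [lia | apply INR_C_nz]).
    assert (E : (4 * INR k ^ 2)%C = RtoC 1).
    { replace (4 * INR k ^ 2)%C with (4 * INR k ^ 2 * (1 - (1 / 2) ^ 2 / INR k ^ 2) + 1)%C
        by (field; auto using C2_nz). rewrite H0. ring. }
    rewrite <- RtoC_pow, <- RtoC_mult in E. apply RtoC_inj in E. nra.
  + apply sine_factor_tends.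
  + replace (Cinfprod (sine_factor (1 / 2)))
      with (Cinfprod (sine_factor (1 / 2)) / (4 * Ci) * (4 * Ci))%C.
    * rewrite H. ring.
    * field. exact Ci_nz.
- intros x.
  pose proof (fun y => csin_ratio_tends y) as Hr.
  set (G := fun y j => (C2pow (S j) * csin (y / C2pow (S j)) * csin (y / C2pow (S j) + 1 / 2) *
            Cprod (csin_ratio j y) (2 ^ j - 1))%C).
  assert (HG : forall y, tends eventually (G y)
    (2 * PI * Ci * y * (2 * Ci) * Cinfprod (sine_factor y))%C).
  { intros y. apply (tends_mult eventually); [| apply Hr].
    apply (tends_mult eventually).
    - apply (tends_C2pow (fun n => n * csin (y / n))%C), csin_slope.
    - apply (tends_C2pow (fun n => csin (y / n + 1 / 2))%C), csin_plus_half_tends. }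
  (* At each [j] the unknown constant [c] of [csin_ratio_factor] is common to [x] and 1/2, so
     cross-multiplication removes it before the limit is taken. *)
  assert (E : (csin x * (2 * PI * Ci * (1 / 2) * (2 * Ci) * Cinfprod (sine_factor (1 / 2))))%C =
              (csin (1 / 2) * (2 * PI * Ci * x * (2 * Ci) * Cinfprod (sine_factor x)))%C).
  { apply (tends_unique eventually (fun j => csin x * G (1 / 2)%C j)%C).
    - apply (tends_mult eventually); [apply (tends_const eventually) | apply HG].
    - apply (tends_ext eventually (fun j => csin (1 / 2) * G x j)%C).
      + intros j. destruct (csin_ratio_factor j) as [c Hc].
        rewrite (Hc x) at 1. rewrite (Hc (1 / 2)%C) at 1. unfold G. ring.
      + apply (tends_mult eventually); [apply (tends_const eventually) | apply HG]. }
  replace (Cinfprod (sine_factor (1 / 2)) / (4 * Ci) * csin x)%C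
    with (x * Cinfprod (sine_factor x))%C.
  + apply (tends_mult eventually); [apply (tends_const eventually) | apply sine_factor_tends].
  + rewrite Hcs in E.
    assert (HPi : RtoC PI <> RtoC 0)
      by (intros H; apply RtoC_inj in H; pose proof PI_RGT_0; lra).
    transitivity (2 * Ci * (2 * PI * Ci * x * (2 * Ci) * Cinfprod (sine_factor x))
      / (8 * PI * (Ci * (Ci * Ci))))%C.
    * field; repeat split; auto using Ci_nz.
    * rewrite <- E. field; repeat split; auto using Ci_nz.
Qed.

(** * The lattice product *)

(** Up to the denominator k^4, both sides are the product of the four linear factors k + x + z, k +
    x - z, k - x + z, k - x - z, grouped in two ways. *)
Lemma sine_factor_shift (x z : C) k : (1 <= k)%nat ->
  (INR k + x)%C <> RtoC 0 -> (INR k - x)%C <> RtoC 0 ->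
  (sine_factor (x + z) k * sine_factor (x - z) k)%C =
  (sine_factor x k * sine_factor x k *
   ((1 - z ^ 2 / (INR k + x) ^ 2) * (1 - z ^ 2 / (INR k - x) ^ 2)))%C.
Proof.
intros Hk H1 H2. unfold sine_factor.
assert (Hk0 : RtoC (INR k) <> RtoC 0) by (destruct k; [lia | apply INR_C_nz]).
field. auto.
Qed.

Lemma sine_factor_neq_0 x k : (1 <= k)%nat ->
  (INR k + x)%C <> RtoC 0 -> (INR k - x)%C <> RtoC 0 -> sine_factor x k <> RtoC 0.
Proof.
intros Hk H1 H2.
assert (Hk0 : RtoC (INR k) <> RtoC 0) by (destruct k; [lia | apply INR_C_nz]).
replace (sine_factor x k) with ((INR k + x) * (INR k - x) / INR k ^ 2)%C
  by (unfold sine_factor; field; exact Hk0).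
apply Cmult_neq_0; [now apply Cmult_neq_0 |].
intros H. apply (Cpow_nz _ 2) in Hk0. apply Hk0.
replace (INR k ^ 2)%C with (INR k ^ 2 * (INR k ^ 2 * / INR k ^ 2))%C
  by (rewrite Cinv_r by exact Hk0; ring).
rewrite H. ring.
Qed.

(** The sine products at x + z and x - z, divided by the square of the one at x: [kap] cancels, and
    what remains runs over the points x + m for all integers m. *)
Lemma row_product (x z : C) : x <> RtoC 0 -> csin x <> RtoC 0 ->
  (forall k, (1 <= k)%nat -> (INR k + x)%C <> RtoC 0 /\ (INR k - x)%C <> RtoC 0) ->
  tends eventually (fun M => (1 - z ^ 2 / x ^ 2) *
    Cprod (fun k => (1 - z ^ 2 / (INR k + x) ^ 2) * (1 - z ^ 2 / (INR k - x) ^ 2)) M)%C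
    (csin (x + z) * csin (x - z) / (csin x * csin x))%C.
Proof.
intros Hx Hs Hk. destruct csin_product as [kap [Hkap HP]].
set (P := fun y M => (y * Cprod (sine_factor y) M)%C).
apply (tends_ext eventually (fun M => P (x + z)%C M * P (x - z)%C M / (P x M * P x M))%C).
- intros M. unfold P.
  assert (Hne : Cprod (sine_factor x) M <> RtoC 0).
  { apply Cprod_neq_0. intros k Hk1. destruct (Hk k ltac:(lia)).
    apply sine_factor_neq_0; [lia | assumption | assumption]. }
  transitivity ((x + z) * (x - z) * (Cprod (sine_factor (x + z)) M * Cprod (sine_factor (x - z)) M)
    / (x * x * (Cprod (sine_factor x) M * Cprod (sine_factor x) M)))%C; [field; auto |].
  rewrite <- Cprod_mult.
  rewrite (Cprod_ext (fun k => sine_factor (x + z) k * sine_factor (x - z) k)%C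
    (fun k => sine_factor x k * sine_factor x k *
    ((1 - z ^ 2 / (INR k + x) ^ 2) * (1 - z ^ 2 / (INR k - x) ^ 2)))%C).
  + rewrite !Cprod_mult. field. auto.
  + intros k Hk1. destruct (Hk k ltac:(lia)). apply sine_factor_shift; [lia | assumption | assumption].
- replace (csin (x + z) * csin (x - z) / (csin x * csin x))%C
    with (kap * csin (x + z) * (kap * csin (x - z)) / (kap * csin x * (kap * csin x)))%C
    by (field; auto).
  apply (tends_div eventually); [repeat apply Cmult_neq_0; assumption | |];
    apply (tends_mult eventually); apply HP.
Qed.

(** * Theta as a product over the rows of the lattice *)

(** This is q^2, as [cis tau] is q: the products involve even powers of q only. *)
Definition qnome (tau : C) : C := (cis tau ^ 2)%C.

(** The denominator makes the factor 1 at z = 0, as are the lattice factors 1 - z^2/w^2 that it has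
    to match. *)
Definition qfactor (z tau : C) (n : nat) : C :=
  ((1 - cis z ^ 2 * qnome tau ^ n) * (1 - / cis z ^ 2 * qnome tau ^ n)
   / (1 - qnome tau ^ n) ^ 2)%C.

(** This is [theta1] divided by [- Ci * eta3 tau]; near z = 0 it behaves like 2 i PI z, whatever
    [tau] is. *)
Definition theta (z tau : C) : C := (csin z * Cinfprod (qfactor z tau))%C.

Lemma qnome_lt_1 tau : 0 < Im tau -> Cmod (qnome tau) < 1.
Proof.
intros H. unfold qnome. rewrite Cmod_pow, Cmod_cis.
pose proof PI_RGT_0. pose proof (exp_pos (- PI * Im tau)).
assert (exp (- PI * Im tau) < 1) by (rewrite <- exp_0; apply exp_increasing; nra).
simpl. nra.
Qed.

Lemma one_minus_pow_neq_0 (x : C) n : Cmod x < 1 -> (1 <= n)%nat -> (1 - x ^ n)%C <> RtoC 0.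
Proof.
intros Hx Hn H.
assert (E : Cmod (x ^ n)%C = 1).
{ rewrite <- Cmod_1. f_equal. replace (x ^ n)%C with (1 - (1 - x ^ n))%C by ring.
  rewrite H. ring. }
rewrite Cmod_pow in E. destruct n as [|n]; [lia |]. simpl in E.
pose proof (Cmod_ge_0 x).
assert (Cmod x ^ n <= 1) by (rewrite <- (pow1 n); apply pow_incr; lra).
pose proof (pow_le (Cmod x) n ltac:(lra)). nra.
Qed.

Lemma qnome_pow tau n : (qnome tau ^ n)%C = (cis (INR n * tau) ^ 2)%C.
Proof. unfold qnome. rewrite <- cis_pow, <- !Cpow_mult_r. f_equal. lia. Qed.

Lemma csin_factored a : csin a = (- / cis a * (1 - cis a ^ 2))%C.
Proof. unfold csin. rewrite cis_opp. field. apply cis_neq_0. Qed.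

Lemma csin_neq_0 a : (1 - cis a ^ 2)%C <> RtoC 0 -> csin a <> RtoC 0.
Proof.
intros H. rewrite csin_factored. apply Cmult_neq_0; [| exact H].
intros E. apply (cis_neq_0 (- a)). rewrite cis_opp.
replace (/ cis a)%C with (- - / cis a)%C by ring. rewrite E. ring.
Qed.

Lemma qfactor_csin z tau n : 0 < Im tau -> (1 <= n)%nat ->
  qfactor z tau n = (csin (INR n * tau + z) * csin (INR n * tau - z) /
    (csin (INR n * tau) * csin (INR n * tau)))%C.
Proof.
intros Ht Hn. unfold qfactor.
pose proof (one_minus_pow_neq_0 _ n (qnome_lt_1 _ Ht) Hn) as H1.
rewrite qnome_pow in *. set (x := (INR n * tau)%C) in *.
rewrite !csin_factored. unfold Cminus.
rewrite !cis_plus, !cis_opp.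
field. repeat split; auto using cis_neq_0.
Qed.

Lemma lattice_neq_0 (tau : C) m n : 0 < Im tau -> (1 <= n)%nat ->
  (RtoC (IZR m) + RtoC (INR n) * tau)%C <> RtoC 0.
Proof.
intros Ht Hn H. apply (f_equal Im) in H. destruct tau as [a b]. simpl in *.
assert (0 < INR n) by (apply lt_0_INR; lia). nra.
Qed.

Lemma row_neq_0 (tau : C) k n : 0 < Im tau -> (1 <= n)%nat ->
  (INR k + INR n * tau)%C <> RtoC 0 /\ (INR k - INR n * tau)%C <> RtoC 0.
Proof.
intros Ht Hn. rewrite INR_IZR_INZ. split; [now apply lattice_neq_0 |].
intros H. apply (lattice_neq_0 tau (- Z.of_nat k) n Ht Hn).
rewrite opp_IZR, RtoC_opp.
replace (- IZR (Z.of_nat k) + INR n * tau)%C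
  with (- (IZR (Z.of_nat k) - INR n * tau))%C by ring.
rewrite H. ring.
Qed.

Lemma ntau_neq_0 (tau : C) n : 0 < Im tau -> (1 <= n)%nat -> (INR n * tau)%C <> RtoC 0.
Proof.
intros Ht Hn H. apply (lattice_neq_0 tau 0 n Ht Hn). rewrite H. ring.
Qed.

(** The factor is a quotient of sines at n tau + z, n tau - z and n tau, so it is the row of all m +
    n tau with m an integer; m - n tau stands for the point -m + n tau, up to sign. *)
Lemma qfactor_row z tau n : 0 < Im tau -> (1 <= n)%nat ->
  tends eventually (fun M => (1 - z ^ 2 / (INR n * tau) ^ 2) *
    Cprod (fun m => (1 - z ^ 2 / (INR m + INR n * tau) ^ 2) *
                    (1 - z ^ 2 / (INR m - INR n * tau) ^ 2)) M)%C
    (qfactor z tau n).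
Proof.
intros Ht Hn. rewrite qfactor_csin by assumption. apply row_product.
- now apply ntau_neq_0.
- apply csin_neq_0. rewrite <- qnome_pow. apply one_minus_pow_neq_0; [now apply qnome_lt_1 | exact Hn].
- intros k _. now apply row_neq_0.
Qed.

Lemma one_minus_pow_ge (x : C) n : Cmod x < 1 -> (1 <= n)%nat -> 1 - Cmod x <= Cmod (1 - x ^ n)%C.
Proof.
intros Hx Hn.
pose proof (Cmod_triangle (1 - x ^ n) (x ^ n)) as Ht.
replace (1 - x ^ n + x ^ n)%C with (RtoC 1) in Ht by ring.
rewrite Cmod_1, Cmod_pow in Ht.
assert (Cmod x ^ n <= Cmod x); [| lra].
destruct n as [|n]; [lia |]. simpl. pose proof (Cmod_ge_0 x).
assert (Cmod x ^ n <= 1) by (rewrite <- (pow1 n); apply pow_incr; lra).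
nra.
Qed.

Lemma qfactor_bound z tau : 0 < Im tau -> exists K, 0 <= K /\
  forall n, (1 <= n)%nat -> Cmod (qfactor z tau n - 1)%C <= K * Cmod (qnome tau) ^ n.
Proof.
intros Ht. set (Q := qnome tau). pose proof (qnome_lt_1 tau Ht) as HQ. fold Q in HQ.
set (v := (cis z ^ 2)%C).
set (c := 1 - Cmod Q). assert (Hc : 0 < c) by (unfold c; lra).
pose proof (Cmod_ge_0 (2 - v - / v)%C) as H0.
assert (Hv : v <> RtoC 0) by apply Cpow_nz, cis_neq_0.
exists (Cmod (2 - v - / v)%C / c ^ 2). split.
{ apply Rdiv_le_0_compat; [exact H0 | nra]. }
intros n Hn. unfold qfactor. fold Q v.
pose proof (one_minus_pow_neq_0 Q n HQ Hn) as H1.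
pose proof (one_minus_pow_ge Q n HQ Hn) as H2. fold c in H2.
(* Numerator and denominator agree in the terms 1 and Q^(2n), so only the one in Q^n survives. *)
replace ((1 - v * Q ^ n) * (1 - / v * Q ^ n) / (1 - Q ^ n) ^ 2 - 1)%C
  with ((2 - v - / v) * Q ^ n / (1 - Q ^ n) ^ 2)%C by (field; auto).
rewrite Cmod_div by now apply Cpow_nz.
rewrite Cmod_mult, !Cmod_pow.
unfold Rdiv. rewrite Rmult_assoc, (Rmult_comm (Cmod Q ^ n)), <- Rmult_assoc.
apply Rmult_le_compat_r; [apply pow_le, Cmod_ge_0 |].
apply Rmult_le_compat_l; [exact H0 |].
apply Rinv_le_contravar; [nra |]. apply pow_incr. lra.
Qed.

Lemma qfactor_tends z tau : 0 < Im tau ->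
  tends eventually (Cprod (qfactor z tau)) (Cinfprod (qfactor z tau)).
Proof.
intros Ht. destruct (qfactor_bound z tau Ht) as [K [HK Hb]].
apply Cprod_tends with (2 := Hb). apply summable_scal; [exact HK |].
apply summable_geom. split; [apply Cmod_ge_0 | now apply qnome_lt_1].
Qed.

Definition off_lattice (z tau : C) : Prop :=
  forall m n : Z, z <> (IZR m + IZR n * tau)%C.

Lemma cis_sqr_eq_1 x : (1 - cis x ^ 2)%C = RtoC 0 -> exists k : Z, x = RtoC (IZR k).
Proof.
intros H. apply cis_mult_self_eq_1.
replace (cis x * cis x)%C with (1 - (1 - cis x ^ 2))%C by ring. rewrite H. ring.
Qed.

Lemma theta_neq_0 z tau : 0 < Im tau -> off_lattice z tau -> theta z tau <> RtoC 0.
Proof.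
intros Ht Hz. unfold theta.
apply Cmult_neq_0.
{ apply csin_neq_0. intros H. apply cis_sqr_eq_1 in H. destruct H as [k Hk].
  apply (Hz k 0%Z). rewrite Hk. ring. }
destruct (qfactor_bound z tau Ht) as [K [HK Hb]].
apply (Cprod_lim_neq_0 (qfactor z tau) (fun n => K * Cmod (qnome tau) ^ n)).
- apply summable_scal; [exact HK |].
  apply summable_geom. split; [apply Cmod_ge_0 | now apply qnome_lt_1].
- exact Hb.
- intros n Hn. unfold qfactor.
  pose proof (one_minus_pow_neq_0 _ n (qnome_lt_1 _ Ht) Hn) as H1.
  assert (Hp : forall y, (1 - cis y ^ 2 * qnome tau ^ n)%C = (1 - cis (y + INR n * tau) ^ 2)%C).
  { intros y. rewrite qnome_pow, cis_plus, Cpow_mult_l. reflexivity. }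
  rewrite <- Cpow_inv, <- cis_opp, !Hp by apply cis_neq_0.
  apply Cmult_neq_0; [apply Cmult_neq_0 |].
  + intros H. apply cis_sqr_eq_1 in H. destruct H as [k Hk].
    apply (Hz k (- Z.of_nat n)%Z). rewrite <- Hk, opp_IZR, <- INR_IZR_INZ, RtoC_opp. ring.
  + intros H. apply cis_sqr_eq_1 in H. destruct H as [k Hk].
    apply (Hz (- k)%Z (Z.of_nat n)). rewrite <- INR_IZR_INZ, opp_IZR, RtoC_opp, <- Hk. ring.
  + intros H. apply (Cpow_nz _ 2) in H1. apply C1_nz.
    rewrite <- (Cinv_r _ H1), H. ring.
- now apply qfactor_tends.
Qed.

(* Equal to 1 + O(w^-4): the terms in [/ w ^ 2] cancel. *)
Definition cross_factor (s1 s2 w : C) : C :=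
  ((1 - s1 / w ^ 2) * (1 - s2 / w ^ 2) / (1 - (s1 + s2) / w ^ 2))%C.

Lemma positive_min (h : nat -> R) N : (forall k, 0 < h k) ->
  exists c, 0 < c /\ forall k, (k <= N)%nat -> c <= h k.
Proof.
intros H. induction N as [|N [c [Hc IH]]].
- exists (h 0%nat). split; [apply H |]. intros k Hk. replace k with 0%nat by lia. lra.
- exists (Rmin c (h (S N))). split; [apply Rmin_glb_lt; [exact Hc | apply H] |].
  intros k Hk. destruct (Nat.eq_dec k (S N)) as [-> | Hne]; [apply Rmin_r |].
  apply Rle_trans with c; [apply Rmin_l | apply IH; lia].
Qed.

Lemma positive_min2 (h : nat -> nat -> R) N : (forall k l, 0 < h k l) ->
  exists c, 0 < c /\ forall k l, (k <= N)%nat -> (l <= N)%nat -> c <= h k l.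
Proof.
intros H.
assert (Hrow : forall M, exists c, 0 < c /\
  forall k l, (k <= M)%nat -> (l <= N)%nat -> c <= h k l).
{ induction M as [|M [c [Hc IH]]].
  - destruct (positive_min (h 0%nat) N (H 0%nat)) as [c [Hc Hh]].
    exists c. split; [exact Hc |]. intros k l Hk Hl.
    replace k with 0%nat by lia. now apply Hh.
  - destruct (positive_min (h (S M)) N (H (S M))) as [d [Hd Hh]].
    exists (Rmin c d). split; [now apply Rmin_glb_lt |]. intros k l Hk Hl.
    destruct (Nat.eq_dec k (S M)) as [-> | Hne].
    + apply Rle_trans with d; [apply Rmin_r | now apply Hh].
    + apply Rle_trans with c; [apply Rmin_l | apply IH; lia]. }
apply Hrow.
Qed.

(** With r = |sg| and x = [Re sg], the square is m^2 + 2 m n x + n^2 r^2 >= 2 m n (r - |x|) by (m -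
    n r)^2 >= 0, and r > |x| as [Im sg <> 0]. A bound by m n, unlike one by m^2 + n^2, splits into a
    function of [m] times one of [n]. *)
Lemma Cmod_lattice_ge (sg : C) : Im sg <> 0 -> exists d, 0 < d /\
  forall m n : nat, d * (INR m * INR n) <= Cmod (INR m + INR n * sg)%C ^ 2.
Proof.
intros Hs. destruct sg as [x y]. simpl in Hs.
assert (Hm2 : Cmod (x, y) ^ 2 = x ^ 2 + y ^ 2) by (rewrite Cmod2_alt; reflexivity).
set (r := Cmod (x, y)) in *.
assert (Hr : Rabs x < r).
{ pose proof (Cmod_ge_0 (x, y)) as Hr0. fold r in Hr0. rewrite <- (Rabs_pos_eq r) by exact Hr0.
  apply Rsqr_lt_abs_0. unfold Rsqr. assert (0 < y * y) by now apply Rsqr_pos_lt in Hs. nra. }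
exists (2 * (r - Rabs x)). split; [lra |].
intros m n. rewrite Cmod2_alt. simpl Re. simpl Im.
pose proof (pos_INR m). pose proof (pos_INR n).
set (a := INR m) in *. set (b := INR n) in *.
assert (Hax : - Rabs x <= x) by (pose proof (Rle_abs (- x)); rewrite Rabs_Ropp in *; lra).
assert (Hab : 0 <= a * b) by nra.
assert (a * b * - Rabs x <= a * b * x) by (apply Rmult_le_compat_l; lra).
assert (0 <= (a - b * r) ^ 2) by apply pow2_ge_0.
replace ((a + (b * x - 0 * y)) ^ 2 + (0 + (b * y + 0 * x)) ^ 2)
  with (a ^ 2 + 2 * (a * b * x) + b ^ 2 * r ^ 2) by (rewrite Hm2; ring).
nra.
Qed.

(** The factor differs from 1 by (s1 s2 / w^4) / (1 - s3/w^2). The lower bound for |w|^2 handles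
    w^4. The denominator is at least 1/2 when w is large, and finitely many remaining w leave a
    positive minimum. *)
Lemma cross_factor_bound (s1 s2 sg : C) : Im sg <> 0 ->
  (forall m n, (1 <= m)%nat -> (1 <= n)%nat ->
    (INR m + INR n * sg)%C <> RtoC 0 /\
    (1 - (s1 + s2) / (INR m + INR n * sg) ^ 2)%C <> RtoC 0) ->
  exists K, 0 <= K /\ forall m n, (1 <= m)%nat -> (1 <= n)%nat ->
    Cmod (cross_factor s1 s2 (INR m + INR n * sg) - 1)%C
      <= K * (/ (INR m * INR m) * / (INR n * INR n)).
Proof.
intros Hsg H0. destruct (Cmod_lattice_ge sg Hsg) as [d [Hd Hlow]].
set (s3 := (s1 + s2)%C) in *.
set (g := fun m n : nat => Cmod (1 - s3 / (INR m + INR n * sg) ^ 2)%C).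
(* As soon as one index exceeds [N], d m n >= 2 |s3|, hence |s3/w^2| <= 1/2. *)
destruct (nfloor_ex (2 * Cmod s3 / d)) as [N [_ HN]].
{ apply Rdiv_le_0_compat; [pose proof (Cmod_ge_0 s3); lra | exact Hd]. }
destruct (positive_min2 (fun m n => g (S m) (S n)) (S N)) as [c0 [Hc0 Hmin]].
{ intros m n. apply Cmod_gt_0. apply H0; lia. }
set (c := Rmin c0 (/ 2)).
assert (Hc : 0 < c) by (apply Rmin_glb_lt; lra).
assert (Hfar : forall m n, (1 <= m)%nat -> (1 <= n)%nat -> 2 * Cmod s3 / d <= INR m * INR n ->
  / 2 <= g m n).
{ intros m n Hm Hn Hbig. unfold g. destruct (H0 m n Hm Hn) as [Hw _].
  specialize (Hlow m n). set (w := (INR m + INR n * sg)%C) in *.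
  assert (Hw2 : 0 < Cmod w ^ 2) by (apply pow_lt; now apply Cmod_gt_0).
  assert (Hq : Cmod (s3 / w ^ 2)%C <= / 2).
  { rewrite Cmod_div, Cmod_pow by now apply Cpow_nz.
    apply Rmult_le_reg_r with (1 := Hw2). unfold Rdiv.
    rewrite Rmult_assoc, Rinv_l by lra.
    apply (Rmult_le_compat_l d) in Hbig; [| lra].
    replace (d * (2 * Cmod s3 / d)) with (2 * Cmod s3) in Hbig by (field; lra). lra. }
  pose proof (Cmod_triangle (1 - s3 / w ^ 2) (s3 / w ^ 2)) as Ht.
  replace (1 - s3 / w ^ 2 + s3 / w ^ 2)%C with (RtoC 1) in Ht by ring.
  rewrite Cmod_1 in Ht. lra. }
assert (Hge : forall m, (N < m)%nat -> 2 * Cmod s3 / d <= INR m).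
{ intros m Hm. apply le_INR in Hm. rewrite S_INR in Hm. lra. }
assert (Hone : forall m, (1 <= m)%nat -> 1 <= INR m) by (intros m Hm; now apply (le_INR 1)).
assert (Hg : forall m n, (1 <= m)%nat -> (1 <= n)%nat -> c <= g m n).
{ intros m n Hm Hn. pose proof (Hone m Hm). pose proof (Hone n Hn).
  destruct (Nat.le_gt_cases m N) as [Hm1 | Hm1]; [destruct (Nat.le_gt_cases n N) as [Hn1 | Hn1] |].
  - apply Rle_trans with c0; [apply Rmin_l |].
    destruct m as [|m]; [lia |]. destruct n as [|n]; [lia |]. apply Hmin; lia.
  - apply Rle_trans with (/ 2); [apply Rmin_r |].
    apply Hfar; [exact Hm | exact Hn |]. specialize (Hge n Hn1). nra.
  - apply Rle_trans with (/ 2); [apply Rmin_r |].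
    apply Hfar; [exact Hm | exact Hn |]. specialize (Hge m Hm1). nra. }
exists (Cmod s1 * Cmod s2 / (c * d ^ 2)).
pose proof (Cmod_ge_0 s1) as Hs1. pose proof (Cmod_ge_0 s2) as Hs2.
split. { apply Rdiv_le_0_compat; [nra |]. apply Rmult_lt_0_compat; [exact Hc | nra]. }
intros m n Hm Hn. destruct (H0 m n Hm Hn) as [Hw H3].
set (w := (INR m + INR n * sg)%C) in *.
specialize (Hg m n Hm Hn). unfold g in Hg. fold w in Hg.
assert (Hd2 : (w ^ 2 - s3)%C <> RtoC 0).
{ intros H. apply H3. replace (1 - s3 / w ^ 2)%C with ((w ^ 2 - s3) / w ^ 2)%C by (field; exact Hw).
  rewrite H. field. exact Hw. }
replace (cross_factor s1 s2 w - 1)%C with (s1 * s2 / (w ^ 2 * w ^ 2) / (1 - s3 / w ^ 2))%C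
  by (unfold cross_factor; unfold s3 in *; field; auto).
rewrite !Cmod_div, !Cmod_mult, Cmod_pow; try assumption.
2:{ apply Cmult_neq_0; now apply Cpow_nz. }
specialize (Hlow m n). fold w in Hlow.
assert (Hm1 : 1 <= INR m) by (apply (le_INR 1); exact Hm).
assert (Hn1 : 1 <= INR n) by (apply (le_INR 1); exact Hn).
set (p := INR m * INR n) in *. assert (Hp : 1 <= p) by (unfold p; nra).
replace (Cmod s1 * Cmod s2 / (c * d ^ 2) * (/ (INR m * INR m) * / (INR n * INR n)))
  with (Cmod s1 * Cmod s2 * / ((d * p) * (d * p)) * / c) by (unfold p; field; lra).
assert (0 < d * p) by nra.
apply Rmult_le_compat.
- apply Rdiv_le_0_compat; [nra | apply Rmult_lt_0_compat; nra].
- left. apply Rinv_0_lt_compat. lra.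
- apply Rmult_le_compat_l; [nra |]. apply Rinv_le_contravar; [nra |].
  apply Rmult_le_compat; lra.
- apply Rinv_le_contravar; assumption.
Qed.

Lemma off_lattice_factor z tau (m n : Z) : off_lattice z tau ->
  (IZR m + IZR n * tau)%C <> RtoC 0 ->
  (1 - z ^ 2 / (IZR m + IZR n * tau) ^ 2)%C <> RtoC 0.
Proof.
intros Hz Hw H. set (w := (IZR m + IZR n * tau)%C) in *.
assert (H1 : (w - z)%C <> RtoC 0).
{ intros E. apply (Hz m n). fold w. replace z with (w - (w - z))%C by ring. rewrite E. ring. }
assert (H2 : (w + z)%C <> RtoC 0).
{ intros E. apply (Hz (- m)%Z (- n)%Z). rewrite !opp_IZR, !RtoC_opp.
  replace (- IZR m + - IZR n * tau)%C with (- w)%C by (unfold w; ring).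
  replace z with (w + z - w)%C by ring. rewrite E. ring. }
apply (Cmult_neq_0 _ _ H1 H2).
replace ((w - z) * (w + z))%C with (w ^ 2 * (1 - z ^ 2 / w ^ 2))%C by (field; exact Hw).
rewrite H. ring.
Qed.

(** * The cross relation between three theta values *)

Section CrossRatio.

Variables (tau z1 z2 z3 : C).
Hypothesis Htau : 0 < Im tau.
Hypothesis Hz3 : (z3 ^ 2)%C = (z1 ^ 2 + z2 ^ 2)%C.
Hypothesis Hoff : off_lattice z3 tau.

Let cf := cross_factor (z1 ^ 2) (z2 ^ 2).

Lemma cross_factor_eq (m n : Z) : (IZR m + IZR n * tau)%C <> RtoC 0 ->
  ((1 - z1 ^ 2 / (IZR m + IZR n * tau) ^ 2) * (1 - z2 ^ 2 / (IZR m + IZR n * tau) ^ 2))%C =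
  ((1 - z3 ^ 2 / (IZR m + IZR n * tau) ^ 2) * cf (IZR m + IZR n * tau))%C.
Proof.
intros Hw. pose proof (off_lattice_factor z3 tau m n Hoff Hw) as H.
set (w := (IZR m + IZR n * tau)%C) in *. unfold cf, cross_factor. rewrite <- Hz3.
assert (Hd : (w ^ 2 - z3 ^ 2)%C <> RtoC 0).
{ intros E. apply H.
  replace (1 - z3 ^ 2 / w ^ 2)%C with ((w ^ 2 - z3 ^ 2) / w ^ 2)%C by (field; exact Hw).
  rewrite E. field. exact Hw. }
field. auto.
Qed.

Lemma int_neq_0 k : (1 <= k)%nat -> RtoC (INR k) <> RtoC 0.
Proof. destruct k; [lia |]. intros _. apply INR_C_nz. Qed.

Lemma cross_int k : (1 <= k)%nat ->
  (sine_factor z1 k * sine_factor z2 k)%C = (sine_factor z3 k * cf (INR k))%C.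
Proof.
intros Hk. pose proof (cross_factor_eq (Z.of_nat k) 0) as H.
rewrite <- INR_IZR_INZ in H.
replace (INR k + 0 * tau)%C with (RtoC (INR k)) in H by ring.
exact (H (int_neq_0 k Hk)).
Qed.

Lemma cross_ntau n : (1 <= n)%nat ->
  ((1 - z1 ^ 2 / (INR n * tau) ^ 2) * (1 - z2 ^ 2 / (INR n * tau) ^ 2))%C =
  ((1 - z3 ^ 2 / (INR n * tau) ^ 2) * cf (INR n * tau))%C.
Proof.
intros Hn. pose proof (cross_factor_eq 0 (Z.of_nat n)) as H.
rewrite <- INR_IZR_INZ in H.
replace (0 + INR n * tau)%C with (INR n * tau)%C in H by ring.
apply H. now apply ntau_neq_0.
Qed.

Lemma cross_plus m n : (1 <= n)%nat ->
  ((1 - z1 ^ 2 / (INR m + INR n * tau) ^ 2) * (1 - z2 ^ 2 / (INR m + INR n * tau) ^ 2))%C =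
  ((1 - z3 ^ 2 / (INR m + INR n * tau) ^ 2) * cf (INR m + INR n * tau))%C.
Proof.
intros Hn. pose proof (cross_factor_eq (Z.of_nat m) (Z.of_nat n)) as H.
rewrite <- !INR_IZR_INZ in H. apply H. now apply row_neq_0.
Qed.

Lemma cross_minus m n : (1 <= n)%nat ->
  ((1 - z1 ^ 2 / (INR m - INR n * tau) ^ 2) * (1 - z2 ^ 2 / (INR m - INR n * tau) ^ 2))%C =
  ((1 - z3 ^ 2 / (INR m - INR n * tau) ^ 2) * cf (INR m - INR n * tau))%C.
Proof.
intros Hn. pose proof (cross_factor_eq (Z.of_nat m) (- Z.of_nat n)) as H.
rewrite opp_IZR, <- !INR_IZR_INZ, RtoC_opp in H.
replace (INR m + - INR n * tau)%C with (INR m - INR n * tau)%C in H by ring.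
apply H. now apply row_neq_0.
Qed.

(* The box product is evaluated by letting its real side grow first. *)
Lemma theta_cross (kap A B L : C) (row : nat -> C) :
  kap <> RtoC 0 ->
  (forall x, tends eventually (fun M => x * Cprod (sine_factor x) M)%C (kap * csin x)%C) ->
  tends eventually (Cprod (fun m => cf (INR m))) A ->
  tends eventually (Cprod (fun n => cf (INR n * tau)%C)) B ->
  (forall n, (1 <= n)%nat -> tends eventually
    (Cprod (fun m => cf (INR m + INR n * tau) * cf (INR m - INR n * tau))%C) (row n)) ->
  tends eventually (Cprod row) L ->
  (kap * theta z1 tau * theta z2 tau * z3)%C = (z1 * z2 * theta z3 tau * A * B * L)%C.
Proof.
intros Hkap HP HA HB Hrow HL.
set (T := fun z N => (csin z * Cprod (qfactor z tau) N)%C).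
assert (HT : forall z, tends eventually (T z) (theta z tau)).
{ intros z. apply (tends_mult eventually); [apply (tends_const eventually) | now apply qfactor_tends]. }
(* For [N] rows and width [M] the relation is an exact identity of finite products; [M] tends to
   infinity with [N] fixed. Each theta value brings one [kap] from the real axis, so one of them is
   left over on the left. *)
assert (HN : forall N, (kap * T z1 N * T z2 N * z3)%C =
  (z1 * z2 * T z3 N * A * (Cprod (fun n => cf (INR n * tau)%C) N * Cprod row N))%C).
{ intros N. rewrite <- Cprod_mult.
  set (P := fun z M => (z * Cprod (sine_factor z) M)%C).
  set (R := fun z n M => ((1 - z ^ 2 / (INR n * tau) ^ 2) *
    Cprod (fun m => (1 - z ^ 2 / (INR m + INR n * tau) ^ 2) *
                    (1 - z ^ 2 / (INR m - INR n * tau) ^ 2)) M)%C).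
  assert (HPR : forall z, tends eventually
    (fun M => P z M * Cprod (fun n => R z n M) N)%C (kap * T z N)%C).
  { intros z. unfold T. rewrite Cmult_assoc. apply (tends_mult eventually); [apply HP |].
    apply (tends_Cprod eventually (fun M n => R z n M)). intros n Hn. now apply qfactor_row. }
  assert (E : (kap * T z1 N * (kap * T z2 N) * z3)%C =
    (z1 * z2 * (kap * T z3 N) * A * Cprod (fun n => cf (INR n * tau)%C * row n)%C N)%C).
  { apply (tends_unique eventually (fun M =>
      (P z1 M * Cprod (fun n => R z1 n M) N) * (P z2 M * Cprod (fun n => R z2 n M) N) * z3)%C).
    - apply (tends_mult eventually); [| apply (tends_const eventually)].
      apply (tends_mult eventually); apply HPR.
    - apply (tends_ext eventually (fun M => z1 * z2 * (P z3 M * Cprod (fun n => R z3 n M) N) *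
        Cprod (fun m => cf (INR m)) M * Cprod (fun n => cf (INR n * tau)%C *
        Cprod (fun m => cf (INR m + INR n * tau) * cf (INR m - INR n * tau))%C M)%C N)%C).
      + intros M. unfold P.
        transitivity (z1 * z2 * z3 * Cprod (fun k => sine_factor z3 k * cf (INR k))%C M *
          Cprod (fun n => R z3 n M * (cf (INR n * tau)%C *
            Cprod (fun m => cf (INR m + INR n * tau) * cf (INR m - INR n * tau))%C M))%C N)%C.
        { rewrite (Cprod_mult (fun n => R z3 n M)), (Cprod_mult (sine_factor z3)). ring. }
        transitivity (z1 * z2 * z3 * Cprod (fun k => sine_factor z1 k * sine_factor z2 k)%C M *
          Cprod (fun n => R z1 n M * R z2 n M)%C N)%C.
        2:{ rewrite !Cprod_mult. ring. }
        f_equal; [f_equal |]; apply Cprod_ext; intros k Hk.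
        * symmetry. apply cross_int. lia.
        * unfold R.
          transitivity ((1 - z3 ^ 2 / (INR k * tau) ^ 2) * cf (INR k * tau) *
            Cprod (fun m => ((1 - z3 ^ 2 / (INR m + INR k * tau) ^ 2) * cf (INR m + INR k * tau)) *
             ((1 - z3 ^ 2 / (INR m - INR k * tau) ^ 2) * cf (INR m - INR k * tau)))%C M)%C.
          { rewrite !Cprod_mult. ring. }
          rewrite <- cross_ntau by lia.
          rewrite (Cprod_ext _ (fun m =>
            ((1 - z1 ^ 2 / (INR m + INR k * tau) ^ 2) * (1 - z2 ^ 2 / (INR m + INR k * tau) ^ 2)) *
            ((1 - z1 ^ 2 / (INR m - INR k * tau) ^ 2) * (1 - z2 ^ 2 / (INR m - INR k * tau) ^ 2)))%C).
          { rewrite !Cprod_mult. ring. }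
          intros m Hm. now rewrite <- cross_plus, <- cross_minus by lia.
      + apply (tends_mult eventually).
        * apply (tends_mult eventually); [| exact HA].
          apply (tends_mult eventually); [apply (tends_const eventually) | apply HPR].
        * apply (tends_Cprod eventually (fun M n => cf (INR n * tau)%C *
            Cprod (fun m => cf (INR m + INR n * tau) * cf (INR m - INR n * tau))%C M)%C).
          intros n Hn. apply (tends_mult eventually); [apply (tends_const eventually) | apply Hrow; lia]. }
  replace (kap * T z1 N * T z2 N * z3)%C
    with (kap * T z1 N * (kap * T z2 N) * z3 / kap)%C by (field; exact Hkap).
  rewrite E. field. exact Hkap. }
replace (z1 * z2 * theta z3 tau * A * B * L)%C
  with (z1 * z2 * theta z3 tau * A * (B * L))%C by ring.
apply (tends_unique eventually (fun N => kap * T z1 N * T z2 N * z3)%C).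
- apply (tends_mult eventually); [| apply (tends_const eventually)].
  apply (tends_mult eventually); [| apply HT].
  apply (tends_mult eventually); [apply (tends_const eventually) | apply HT].
- apply (tends_ext eventually) with (1 := fun N => eq_sym (HN N)).
  apply (tends_mult eventually); [| now apply (tends_mult eventually)].
  apply (tends_mult eventually); [| apply (tends_const eventually)].
  apply (tends_mult eventually); [apply (tends_const eventually) | apply HT].
Qed.

End CrossRatio.

(** * Exchange of the two periods *)

Lemma off_lattice_int z tau k : off_lattice z tau ->
  (INR k + z)%C <> RtoC 0 /\ (INR k - z)%C <> RtoC 0.
Proof.
intros Hz. rewrite INR_IZR_INZ. split; intros H.
- apply (Hz (- Z.of_nat k)%Z 0%Z). rewrite opp_IZR, RtoC_opp.
  replace z with (IZR (Z.of_nat k) + z - IZR (Z.of_nat k))%C by ring. rewrite H. ring.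
- apply (Hz (Z.of_nat k) 0%Z).
  replace z with (IZR (Z.of_nat k) - (IZR (Z.of_nat k) - z))%C by ring. rewrite H. ring.
Qed.

Lemma tau_neq_0 (tau : C) : 0 < Im tau -> tau <> RtoC 0.
Proof. intros Ht H. rewrite H in Ht. simpl in Ht. lra. Qed.

Lemma Im_inversion (tau : C) : 0 < Im tau -> 0 < Im (-1 / tau)%C.
Proof.
intros Ht. destruct tau as [x y]. simpl in *.
replace (-1 * (- y / (x * (x * 1) + y * (y * 1))) + 0 * (x / (x * (x * 1) + y * (y * 1))))
  with (y / (x * x + y * y)) by (field; nra).
apply Rdiv_lt_0_compat; nra.
Qed.

Lemma off_lattice_inversion z tau : 0 < Im tau -> off_lattice z tau -> off_lattice (z / tau)%C (-1 / tau)%C.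
Proof.
intros Ht Hz m n H. pose proof (tau_neq_0 tau Ht) as Ht0.
apply (Hz (- n)%Z m). rewrite opp_IZR, RtoC_opp.
replace z with (z / tau * tau)%C by (field; exact Ht0). rewrite H. field. exact Ht0.
Qed.

(** On an axis the sine products at [z1], [z2] and [z3] converge separately, and the one at [z3] has
    a nonzero limit. The other axis is the same statement for the variables divided by [tau]. *)
Lemma cross_int_tends z1 z2 z3 : (z3 ^ 2)%C = (z1 ^ 2 + z2 ^ 2)%C ->
  (forall k, (1 <= k)%nat -> (INR k + z3)%C <> RtoC 0 /\ (INR k - z3)%C <> RtoC 0) ->
  exists A, tends eventually (Cprod (fun m => cross_factor (z1 ^ 2) (z2 ^ 2) (INR m))) A.
Proof.
intros Hz3 H.
assert (Hs : forall k, (1 <= k)%nat -> sine_factor z3 k <> RtoC 0).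
{ intros k Hk. destruct (H k Hk). now apply sine_factor_neq_0. }
eexists. apply (tends_ext eventually (fun M =>
  Cprod (sine_factor z1) M * Cprod (sine_factor z2) M / Cprod (sine_factor z3) M)%C).
- intros M. unfold Cdiv. rewrite <- Cprod_inv, <- !Cprod_mult by exact Hs.
  apply Cprod_ext. intros k _. unfold cross_factor, sine_factor. now rewrite <- Hz3.
- apply (tends_div eventually); [| apply (tends_mult eventually); apply sine_factor_tends
    | apply sine_factor_tends].
  apply (Cprod_lim_neq_0 (sine_factor z3) (fun k => Cmod z3 ^ 2 * / (INR k * INR k))).
  + apply summable_scal; [apply pow_le, Cmod_ge_0 | apply summable_inv_sqr].
  + apply sine_factor_bound.
  + exact Hs.
  + apply sine_factor_tends.
Qed.

Lemma cross_factor_scale z1 z2 w tau : w <> RtoC 0 -> tau <> RtoC 0 ->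
  cross_factor ((z1 / tau) ^ 2) ((z2 / tau) ^ 2) w = cross_factor (z1 ^ 2) (z2 ^ 2) (w * tau).
Proof.
intros Hw Ht. unfold cross_factor.
replace ((z1 / tau) ^ 2 / w ^ 2)%C with (z1 ^ 2 / (w * tau) ^ 2)%C by (field; auto).
replace ((z2 / tau) ^ 2 / w ^ 2)%C with (z2 ^ 2 / (w * tau) ^ 2)%C by (field; auto).
replace (((z1 / tau) ^ 2 + (z2 / tau) ^ 2) / w ^ 2)%C
  with ((z1 ^ 2 + z2 ^ 2) / (w * tau) ^ 2)%C by (field; auto).
reflexivity.
Qed.

Lemma cross_factor_opp s1 s2 w : cross_factor s1 s2 (- w) = cross_factor s1 s2 w.
Proof. unfold cross_factor. now replace ((- w) ^ 2)%C with (w ^ 2)%C by ring. Qed.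

(** Together m + n tau and m - n tau reach, up to sign, every lattice point off the axes. The bound
    is the one for a single factor, applied with [sg] equal to [tau] and to [- tau]. *)
Lemma cross_pair_bound z1 z2 z3 tau : 0 < Im tau -> (z3 ^ 2)%C = (z1 ^ 2 + z2 ^ 2)%C ->
  off_lattice z3 tau ->
  exists K, 0 <= K /\ forall m n, (1 <= m)%nat -> (1 <= n)%nat ->
    Cmod (cross_factor (z1 ^ 2) (z2 ^ 2) (INR m + INR n * tau) *
          cross_factor (z1 ^ 2) (z2 ^ 2) (INR m - INR n * tau) - 1)%C
      <= K * / (INR m * INR m) * / (INR n * INR n).
Proof.
intros Ht Hz3 Hoff.
destruct (cross_factor_bound (z1 ^ 2) (z2 ^ 2) tau ltac:(lra)) as [K1 [HK1 B1]].
{ intros m n Hm Hn. destruct (row_neq_0 tau m n Ht Hn) as [H1 _]. split; [exact H1 |].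
  rewrite <- Hz3. revert H1. rewrite !INR_IZR_INZ. now apply off_lattice_factor. }
assert (Hmt : forall m n, (INR m + INR n * - tau)%C = (INR m - INR n * tau)%C) by (intros; ring).
destruct (cross_factor_bound (z1 ^ 2) (z2 ^ 2) (- tau)%C) as [K2 [HK2 B2]].
{ destruct tau as [x y]. simpl in *. lra. }
{ intros m n Hm Hn. rewrite Hmt. destruct (row_neq_0 tau m n Ht Hn) as [_ H1]. split; [exact H1 |].
  rewrite <- Hz3. revert H1. rewrite !INR_IZR_INZ.
  replace (IZR (Z.of_nat m) - IZR (Z.of_nat n) * tau)%C
    with (IZR (Z.of_nat m) + IZR (- Z.of_nat n) * tau)%C by (rewrite opp_IZR, RtoC_opp; ring).
  now apply off_lattice_factor. }
exists (K1 + K2 + K1 * K2). split; [nra |].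
intros m n Hm Hn. specialize (B1 m n Hm Hn). specialize (B2 m n Hm Hn). rewrite Hmt in B2.
set (a := cross_factor (z1 ^ 2) (z2 ^ 2) (INR m + INR n * tau)) in *.
set (b := cross_factor (z1 ^ 2) (z2 ^ 2) (INR m - INR n * tau)) in *.
assert (Hm1 : 1 <= INR m) by (apply (le_INR 1); exact Hm).
assert (Hn1 : 1 <= INR n) by (apply (le_INR 1); exact Hn).
set (p := / (INR m * INR m) * / (INR n * INR n)) in *.
assert (Hp : 0 <= p <= 1).
{ unfold p. rewrite <- Rinv_mult. split.
  - left. apply Rinv_0_lt_compat. repeat apply Rmult_lt_0_compat; lra.
  - rewrite <- Rinv_1. apply Rinv_le_contravar; [lra |].
    assert (1 <= INR m * INR m) by nra. assert (1 <= INR n * INR n) by nra. nra. }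
replace (a * b - 1)%C with ((a - 1) + ((b - 1) + (a - 1) * (b - 1)))%C by ring.
eapply Rle_trans; [apply Cmod_triangle |].
eapply Rle_trans; [apply Rplus_le_compat_l, Cmod_triangle |]. rewrite Cmod_mult.
assert (Cmod (a - 1) * Cmod (b - 1) <= (K1 * p) * (K2 * p))
  by (apply Rmult_le_compat; auto using Cmod_ge_0).
assert (K1 * p * (K2 * p) <= K1 * K2 * p).
{ replace (K1 * p * (K2 * p)) with (K1 * K2 * p * p) by ring.
  rewrite <- (Rmult_1_r (K1 * K2 * p)) at 2. apply Rmult_le_compat_l; [| lra].
  apply Rmult_le_pos; nra. }
rewrite Rmult_assoc. fold p. lra.
Qed.

Lemma theta_cross_inversion tau z1 z2 z3 : 0 < Im tau -> (z3 ^ 2)%C = (z1 ^ 2 + z2 ^ 2)%C ->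
  off_lattice z3 tau ->
  (theta z1 tau * theta z2 tau * theta (z3 / tau) (-1 / tau))%C =
  (tau * theta (z1 / tau) (-1 / tau) * theta (z2 / tau) (-1 / tau) * theta z3 tau)%C.
Proof.
intros Ht Hz3 Hoff.
destruct csin_product as [kap [Hkap HP]].
pose proof (tau_neq_0 tau Ht) as Ht0.
pose proof (Im_inversion tau Ht) as Ht'.
pose proof (off_lattice_inversion z3 tau Ht Hoff) as Hoff'.
assert (Hz3' : ((z3 / tau) ^ 2)%C = ((z1 / tau) ^ 2 + (z2 / tau) ^ 2)%C).
{ replace ((z3 / tau) ^ 2)%C with (z3 ^ 2 / tau ^ 2)%C by (field; exact Ht0).
  rewrite Hz3. field. exact Ht0. }
set (cf := cross_factor (z1 ^ 2) (z2 ^ 2)).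
set (cf' := cross_factor ((z1 / tau) ^ 2) ((z2 / tau) ^ 2)).
assert (Hsc : forall w, w <> RtoC 0 -> cf' w = cf (w * tau)%C)
  by (intros w Hw; now apply cross_factor_scale).
destruct (cross_int_tends z1 z2 z3 Hz3 (fun k _ => off_lattice_int z3 tau k Hoff)) as [A HA].
destruct (cross_int_tends _ _ _ Hz3' (fun k _ => off_lattice_int _ _ k Hoff')) as [B HB].
destruct (cross_pair_bound z1 z2 z3 tau Ht Hz3 Hoff) as [K [HK Hb]].
set (a := fun m n : nat => (cf (INR m + INR n * tau) * cf (INR m - INR n * tau))%C).
assert (Hu : summable (fun k => K * / (INR k * INR k)))
  by (apply summable_scal; [exact HK | apply summable_inv_sqr]).
destruct (double_Cprod_exchange a _ _ Hu summable_inv_sqr Hb) as [L [HL HL']].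
assert (E1 : (kap * theta z1 tau * theta z2 tau * z3)%C = (z1 * z2 * theta z3 tau * A * B * L)%C).
{ apply (theta_cross tau z1 z2 z3 Ht Hz3 Hoff kap A B L (fun n => Cinfprod (fun m => a m n)));
    try assumption.
  - apply (tends_ext eventually) with (2 := HB). intros N. apply Cprod_ext.
    intros k Hk. apply Hsc. now apply int_neq_0.
  - intros n Hn. apply Cprod_tends with (u := fun m => / (INR n * INR n) * (K * / (INR m * INR m))).
    + apply summable_scal; [apply summable_inv_sqr | exact Hu].
    + intros m Hm. rewrite Rmult_comm. now apply Hb. }
(* Multiplied by [tau], the points of row n of the inverted lattice are -(n - m tau) and n + m tau:
   the same factors [a] with the indices swapped. So [A] and [B] change places and [L] stays. *)
assert (E2 : (kap * theta (z1 / tau) (-1 / tau) * theta (z2 / tau) (-1 / tau) * (z3 / tau))%C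
  = ((z1 / tau) * (z2 / tau) * theta (z3 / tau) (-1 / tau) * B * A * L)%C).
{ apply (theta_cross (-1 / tau)%C (z1 / tau)%C (z2 / tau)%C (z3 / tau)%C Ht' Hz3' Hoff' kap B A L
    (fun n => Cinfprod (fun m => a n m))); try assumption.
  - apply (tends_ext eventually) with (2 := HA). intros N. apply Cprod_ext.
    intros k Hk. fold cf cf'. rewrite Hsc by now apply ntau_neq_0.
    replace (INR k * (-1 / tau) * tau)%C with (- INR k)%C by (field; exact Ht0).
    unfold cf. now rewrite cross_factor_opp.
  - intros n Hn. fold cf'.
    apply (tends_ext eventually (Cprod (fun m => a n m))).
    + intros M. apply Cprod_ext. intros m Hm.
      destruct (row_neq_0 (-1 / tau)%C m n Ht' Hn) as [H1 H2].
      rewrite !Hsc by assumption. unfold a.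
      replace ((INR m + INR n * (-1 / tau)) * tau)%C with (- (INR n - INR m * tau))%C
        by (field; exact Ht0).
      replace ((INR m - INR n * (-1 / tau)) * tau)%C with (INR n + INR m * tau)%C
        by (field; exact Ht0).
      unfold cf. rewrite cross_factor_opp. ring.
    + apply Cprod_tends with (u := fun m => K * / (INR n * INR n) * / (INR m * INR m)).
      * apply summable_scal; [| apply summable_inv_sqr].
        apply Rmult_le_pos; [exact HK | apply summable_inv_sqr].
      * intros m Hm. now apply Hb. }
assert (Hz30 : z3 <> RtoC 0).
{ intros H. apply (Hoff 0%Z 0%Z). rewrite H. ring. }
set (t1 := theta (z1 / tau) (-1 / tau)) in *. set (t2 := theta (z2 / tau) (-1 / tau)) in *.
set (t3 := theta (z3 / tau) (-1 / tau)) in *.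
transitivity (kap * theta z1 tau * theta z2 tau * z3 * t3 / (kap * z3))%C; [field; auto |].
rewrite E1.
transitivity (tau ^ 2 * (z1 / tau * (z2 / tau) * t3 * B * A * L) * theta z3 tau / (kap * z3))%C;
  [field; auto |].
rewrite <- E2. field. auto.
Qed.

(** * Quasi-periodicity and the inversion up to a constant *)

(** The factors agree only from index 1 on, so the infinite products are compared as limits of equal
    partial products. *)
Lemma theta_scal c z z' tau : 0 < Im tau -> csin z = (c * csin z')%C ->
  (forall n, (1 <= n)%nat -> qfactor z tau n = qfactor z' tau n) ->
  theta z tau = (c * theta z' tau)%C.
Proof.
intros Ht Hs Hq. unfold theta. rewrite Hs, <- Cmult_assoc. do 2 f_equal.
apply (tends_unique eventually (Cprod (qfactor z tau))); [now apply qfactor_tends |].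
apply (tends_ext eventually (Cprod (qfactor z' tau))); [| now apply qfactor_tends].
intros N. apply Cprod_ext. intros k Hk. symmetry. apply Hq. lia.
Qed.

Lemma theta_plus_1 z tau : 0 < Im tau -> theta (z + 1) tau = (- theta z tau)%C.
Proof.
intros Ht. replace (- theta z tau)%C with (- (1) * theta z tau)%C by ring.
apply theta_scal; [exact Ht | rewrite csin_plus_1; ring |].
intros n _. unfold qfactor. rewrite cis_plus, cis_1.
now replace ((cis z * - (1)) ^ 2)%C with (cis z ^ 2)%C by ring.
Qed.

Lemma theta_opp z tau : 0 < Im tau -> theta (- z) tau = (- theta z tau)%C.
Proof.
intros Ht. replace (- theta z tau)%C with (- (1) * theta z tau)%C by ring.
apply theta_scal; [exact Ht | rewrite csin_opp; ring |].
intros n Hn. unfold qfactor. rewrite cis_opp.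
pose proof (one_minus_pow_neq_0 _ n (qnome_lt_1 _ Ht) Hn).
field. repeat split; auto using cis_neq_0.
Qed.

Lemma one_minus_scal_pow_tends (c x : C) : Cmod x < 1 ->
  tends eventually (fun n => 1 - c * x ^ n)%C 1.
Proof.
intros Hx. cut (tends eventually (fun n => 1 - c * x ^ n)%C (1 - c * 0)%C).
{ now replace (1 - c * 0)%C with (RtoC 1) by ring. }
apply (tends_minus eventually); [apply (tends_const eventually) |].
apply (tends_mult eventually); [apply (tends_const eventually) | now apply tends_pow_0].
Qed.

(** Replacing z by z + tau moves one kind of factor up by one index and the other down, so the
    partial products telescope up to two end factors. These tend to 1; they stay as multipliers
    because they may vanish. *)
Lemma qfactor_shift z tau N : 0 < Im tau ->
  (csin (z + tau) * Cprod (qfactor (z + tau) tau) N * (1 - / cis z ^ 2 * qnome tau ^ N))%C =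
  (- / (cis tau * cis z ^ 2) * csin z * Cprod (qfactor z tau) N *
   (1 - cis z ^ 2 * qnome tau ^ S N))%C.
Proof.
intros Ht. induction N as [|N IH].
- simpl Cprod. rewrite Cpow_1_r, (csin_factored (z + tau)), (csin_factored z), cis_plus.
  unfold qnome. field. split; apply cis_neq_0.
- change (Cprod (qfactor (z + tau) tau) (S N))
    with (Cprod (qfactor (z + tau) tau) N * qfactor (z + tau) tau (S N))%C.
  change (Cprod (qfactor z tau) (S N)) with (Cprod (qfactor z tau) N * qfactor z tau (S N))%C.
  pose proof (one_minus_pow_neq_0 _ (S N) (qnome_lt_1 _ Ht) ltac:(lia)) as H1.
  assert (Hq : qfactor (z + tau) tau (S N) =
    ((1 - cis z ^ 2 * qnome tau ^ S (S N)) * (1 - / cis z ^ 2 * qnome tau ^ N)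
     / (1 - qnome tau ^ S N) ^ 2)%C).
  { unfold qfactor. rewrite cis_plus, !(Cpow_S _ N), !(Cpow_S _ (S N)), !(Cpow_S _ N) in *.
    rewrite Cpow_mult_l. change (cis tau ^ 2)%C with (qnome tau).
    field. repeat split; try exact H1; try apply cis_neq_0. apply Cpow_nz, cis_neq_0. }
  rewrite Hq.
  transitivity (csin (z + tau) * Cprod (qfactor (z + tau) tau) N * (1 - / cis z ^ 2 * qnome tau ^ N)
    * ((1 - cis z ^ 2 * qnome tau ^ S (S N)) * (1 - / cis z ^ 2 * qnome tau ^ S N)
       / (1 - qnome tau ^ S N) ^ 2))%C.
  { field. repeat split; auto using cis_neq_0. }
  rewrite IH. unfold qfactor. field. repeat split; auto using cis_neq_0.
Qed.

Lemma theta_plus_tau z tau : 0 < Im tau ->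
  theta (z + tau) tau = (- / (cis tau * cis z ^ 2) * theta z tau)%C.
Proof.
intros Ht. pose proof (qnome_lt_1 tau Ht) as HQ.
apply (tends_unique eventually (fun N => csin (z + tau) * Cprod (qfactor (z + tau) tau) N *
  (1 - / cis z ^ 2 * qnome tau ^ N))%C).
- rewrite <- (Cmult_1_r (theta (z + tau) tau)).
  apply (tends_mult eventually); [| now apply one_minus_scal_pow_tends].
  apply (tends_mult eventually); [apply (tends_const eventually) | now apply qfactor_tends].
- apply (tends_ext eventually) with (1 := fun N => eq_sym (qfactor_shift z tau N Ht)).
  rewrite <- (Cmult_1_r (- / (cis tau * cis z ^ 2) * theta z tau)).
  apply (tends_mult eventually).
  + unfold theta. rewrite Cmult_assoc.
    apply (tends_mult eventually); [apply (tends_const eventually) | now apply qfactor_tends].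
  + apply (tends_subseq S (fun n => 1 - cis z ^ 2 * qnome tau ^ n)%C); [lia |].
    now apply one_minus_scal_pow_tends.
Qed.

Lemma theta_minus_tau z tau : 0 < Im tau ->
  theta (z - tau) tau = (- (cis z ^ 2 / cis tau) * theta z tau)%C.
Proof.
intros Ht. replace z with ((z - tau) + tau)%C at 3 by ring.
rewrite theta_plus_tau by exact Ht. unfold Cminus. rewrite cis_plus, cis_opp.
field. split; apply cis_neq_0.
Qed.

(** The function G of the overview, with [theta] in place of [theta1]. *)
Definition theta_inv (z tau : C) : C := (theta (z / tau) (-1 / tau) * cis (- (z ^ 2 / tau)))%C.

(** Adding 1 to z subtracts the period -1/tau from z/tau; the resulting factor is the inverse of the
    change of the Gaussian, up to the sign. *)
Lemma theta_inv_plus_1 z tau : 0 < Im tau -> theta_inv (z + 1) tau = (- theta_inv z tau)%C.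
Proof.
intros Ht. pose proof (tau_neq_0 tau Ht) as Ht0. unfold theta_inv.
replace ((z + 1) / tau)%C with (z / tau - -1 / tau)%C by (field; exact Ht0).
rewrite theta_minus_tau by now apply Im_inversion.
replace (- ((z + 1) ^ 2 / tau))%C with (- (z ^ 2 / tau) + (- (z / tau) + (- (z / tau) + -1 / tau)))%C
  by (field; exact Ht0).
rewrite !cis_plus, !cis_opp. field. repeat split; apply cis_neq_0.
Qed.

Lemma theta_inv_cross tau z1 z2 z3 : 0 < Im tau -> (z3 ^ 2)%C = (z1 ^ 2 + z2 ^ 2)%C ->
  off_lattice z3 tau ->
  (theta z1 tau * theta z2 tau * theta_inv z3 tau)%C =
  (tau * theta_inv z1 tau * theta_inv z2 tau * theta z3 tau)%C.
Proof.
intros Ht Hz Hoff. unfold theta_inv.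
replace (- (z3 ^ 2 / tau))%C with (- (z1 ^ 2 / tau) + - (z2 ^ 2 / tau))%C
  by (rewrite Hz; field; now apply tau_neq_0).
rewrite cis_plus.
transitivity (theta z1 tau * theta z2 tau * theta (z3 / tau) (-1 / tau) *
  (cis (- (z1 ^ 2 / tau)) * cis (- (z2 ^ 2 / tau))))%C; [ring |].
rewrite (theta_cross_inversion tau z1 z2 z3 Ht Hz Hoff). ring.
Qed.

Lemma off_lattice_plus_1 z tau : off_lattice z tau -> off_lattice (z + 1) tau.
Proof.
intros Hz m n H. apply (Hz (m - 1)%Z n). rewrite minus_IZR, RtoC_minus.
replace z with (z + 1 - 1)%C by ring. rewrite H. ring.
Qed.

Lemma theta_inv_neq_0 z tau : 0 < Im tau -> off_lattice z tau -> theta_inv z tau <> RtoC 0.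
Proof.
intros Ht Hz. apply Cmult_neq_0; [| apply cis_neq_0].
apply theta_neq_0; [now apply Im_inversion | now apply off_lattice_inversion].
Qed.

(* One of these two points avoids the lattice: they satisfy
   [(u + 1)^2 = u^2 + z^2] and [(u + 2)^2 = u^2 + z^2] respectively. *)
Lemma off_lattice_either z tau : 0 < Im tau ->
  off_lattice ((z ^ 2 - 1) / 2)%C tau \/ off_lattice (z ^ 2 / 4 - 1)%C tau.
Proof.
intros Ht. apply NNPP. intros H. apply not_or_and in H. destruct H as [H1 H2].
apply not_all_ex_not in H1. destruct H1 as [m H1]. apply not_all_ex_not in H1.
destruct H1 as [n H1]. apply NNPP in H1.
apply not_all_ex_not in H2. destruct H2 as [m' H2]. apply not_all_ex_not in H2.
destruct H2 as [n' H2]. apply NNPP in H2.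
(* With both points in the lattice, z^2 has the two expressions 1 + 2a and 4(1 + b) with a, b
   lattice points; their integer parts are odd and even. *)
assert (E : (1 + 2 * (IZR m + IZR n * tau))%C = (4 * (1 + (IZR m' + IZR n' * tau)))%C).
{ rewrite <- H1, <- H2. field. }
assert (EI := f_equal Im E). assert (ER := f_equal Re E). destruct tau as [x y]. simpl in *.
assert (En : 2 * IZR n = 4 * IZR n') by nra.
assert (Em : 1 + 2 * IZR m = 4 * (1 + IZR m')) by nra.
rewrite <- (mult_IZR 2), <- (plus_IZR 1), <- (plus_IZR 1), <- (mult_IZR 4) in Em.
apply eq_IZR in Em. lia.
Qed.

(** In the cross relation for u, z and a translate of u by 1 or 2, both sides pick up the same sign
    and share the nonzero factor [theta u tau * theta_inv u tau]. *)
Lemma theta_eq_theta_inv z tau : 0 < Im tau -> theta z tau = (tau * theta_inv z tau)%C.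
Proof.
intros Ht.
assert (Hcancel : forall u e : C, u <> RtoC 0 -> e <> RtoC 0 ->
  (u * theta z tau * e)%C = (tau * e * theta_inv z tau * u)%C ->
  theta z tau = (tau * theta_inv z tau)%C).
{ intros u e Hu He H.
  transitivity (u * theta z tau * e / (u * e))%C; [field; auto |].
  rewrite H. field. auto. }
destruct (off_lattice_either z tau Ht) as [Hu | Hu].
- set (u := ((z ^ 2 - 1) / 2)%C) in *.
  pose proof (theta_inv_cross tau u z (u + 1)%C Ht) as H.
  rewrite theta_inv_plus_1, theta_plus_1 in H by exact Ht.
  apply (Hcancel (theta u tau) (theta_inv u tau));
    [now apply theta_neq_0 | now apply theta_inv_neq_0 |].
  transitivity (- (theta u tau * theta z tau * - theta_inv u tau))%C; [ring |].
  rewrite H; [ring | unfold u; field | now apply off_lattice_plus_1].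
- set (u := (z ^ 2 / 4 - 1)%C) in *.
  pose proof (theta_inv_cross tau u z (u + 1 + 1)%C Ht) as H.
  rewrite !theta_inv_plus_1, !theta_plus_1 in H by exact Ht.
  apply (Hcancel (theta u tau) (theta_inv u tau));
    [now apply theta_neq_0 | now apply theta_inv_neq_0 |].
  transitivity (theta u tau * theta z tau * - - theta_inv u tau)%C; [ring |].
  rewrite H; [ring | unfold u; field | now do 2 apply off_lattice_plus_1].
Qed.

(** * The multiplier *)

Definition euler (tau : C) : C := Cinfprod (fun n => 1 - qnome tau ^ n)%C.

Lemma one_minus_pow_bound (x : C) k : Cmod (1 - x ^ k - 1)%C <= Cmod x ^ k.
Proof.
replace (1 - x ^ k - 1)%C with (- x ^ k)%C by ring. rewrite Cmod_opp, Cmod_pow. lra.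
Qed.

Lemma euler_tends tau : Cmod (qnome tau) < 1 ->
  tends eventually (Cprod (fun n => 1 - qnome tau ^ n)%C) (euler tau).
Proof.
intros HQ. apply Cprod_tends with (u := fun k => Cmod (qnome tau) ^ k).
- apply summable_geom. split; [apply Cmod_ge_0 | exact HQ].
- intros k _. apply one_minus_pow_bound.
Qed.

Lemma euler_neq_0 tau : 0 < Im tau -> euler tau <> RtoC 0.
Proof.
intros Ht. pose proof (qnome_lt_1 tau Ht) as HQ.
apply (Cprod_lim_neq_0 (fun n => 1 - qnome tau ^ n)%C (fun k => Cmod (qnome tau) ^ k)).
- apply summable_geom. split; [apply Cmod_ge_0 | exact HQ].
- intros k _. apply one_minus_pow_bound.
- intros k Hk. now apply one_minus_pow_neq_0.
- now apply euler_tends.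
Qed.

Lemma tends_pow {T} F {FF : Filter F} (f : T -> C) l n :
  tends F f l -> tends F (fun t => f t ^ n)%C (l ^ n)%C.
Proof.
intros H. induction n as [|n IH]; simpl; [apply (tends_const F) | now apply (tends_mult F)].
Qed.

Lemma euler_continuous {T} F {PF : ProperFilter F} (f : T -> C) tau :
  0 < Im tau -> tends F f tau -> tends F (fun t => euler (f t)) (euler tau).
Proof.
intros Ht Hf. pose proof (qnome_lt_1 tau Ht) as HQ. pose proof (Cmod_ge_0 (qnome tau)) as HQ0.
assert (Hq : tends F (fun t => qnome (f t)) (qnome tau))
  by now apply (tends_pow F), (tends_cis F).
(* The midpoint between |q^2| and 1, so that its powers dominate the factors for all nearby values
   of the parameter. *)
set (r := (1 + Cmod (qnome tau)) / 2).
assert (Hr : 0 <= r < 1) by (unfold r; lra).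
apply (Cprod_limit_exchange F (fun t n => 1 - qnome (f t) ^ n)%C (fun k => r ^ k)
  (fun n => 1 - qnome tau ^ n)%C).
- now apply summable_geom.
- assert (Hd : 0 < (1 - Cmod (qnome tau)) / 2) by lra.
  generalize (Hq _ Hd). apply filter_imp. intros t H.
  assert (Hle : Cmod (qnome (f t)) <= r).
  { pose proof (Cmod_triangle (qnome (f t) - qnome tau) (qnome tau)) as Htr.
    replace (qnome (f t) - qnome tau + qnome tau)%C with (qnome (f t)) in Htr by ring.
    unfold r. lra. }
  split; [| apply euler_tends; lra].
  intros k _. eapply Rle_trans; [apply one_minus_pow_bound |].
  apply pow_incr. split; [apply Cmod_ge_0 | exact Hle].
- intros k _. apply (tends_minus F); [apply (tends_const F) | now apply (tends_pow F)].
- now apply euler_tends.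
Qed.

(* The cube of Dedekind's eta function. *)
Definition eta3 (tau : C) : C := (cis (tau / 4) * euler tau ^ 3)%C.

Lemma eta3_neq_0 tau : 0 < Im tau -> eta3 tau <> RtoC 0.
Proof.
intros Ht. apply Cmult_neq_0; [apply cis_neq_0 | now apply Cpow_nz, euler_neq_0].
Qed.

Lemma eta3_continuous {T} F {PF : ProperFilter F} (f : T -> C) tau :
  0 < Im tau -> tends F f tau -> tends F (fun t => eta3 (f t)) (eta3 tau).
Proof.
intros Ht Hf. apply (tends_mult F).
- apply (tends_cis F). apply (tends_mult F); [exact Hf | apply (tends_const F)].
- apply (tends_pow F). now apply (euler_continuous F).
Qed.

(** The factors in w^-2 lag by one index: the first one, 1 - w^-2, combines with w into [csin z],
    and the partial product up to [S N] exceeds the one of [theta] by two end factors that tend to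
    1. *)
Lemma theta1_theta z tau : 0 < Im tau -> theta1 z tau = (- Ci * eta3 tau * theta z tau)%C.
Proof.
intros Ht. pose proof (qnome_lt_1 tau Ht) as HQ.
unfold theta1. cbv zeta. fold (cis tau). fold (cis z).
replace (PI * Ci * tau / 4)%C with (PI * Ci * (tau / 4))%C by field. fold (cis (tau / 4)).
rewrite (Cinfprod_unique _ ((1 - / cis z ^ 2) * (euler tau ^ 3 * Cinfprod (qfactor z tau)))).
{ unfold eta3, theta, csin. rewrite cis_opp. field. apply cis_neq_0. }
apply tends_filterlim, tends_incr_1.
apply (tends_ext eventually (fun N => (1 - / cis z ^ 2) *
  (Cprod (fun n => 1 - qnome tau ^ n)%C N ^ 3 * Cprod (qfactor z tau) N) *
  ((1 - 1 * qnome tau ^ S N) * (1 - cis z ^ 2 * qnome tau ^ S N)))%C).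
- intros N. induction N as [|N IH].
  + unfold qnome. simpl. ring.
  + match type of IH with _ = Cprod ?f _ =>
      change (Cprod f (S (S N))) with (Cprod f (S N) * f (S (S N)))%C end.
    cbv beta. rewrite <- IH.
    replace (2 * S (S N) - 2)%nat with (2 * S N)%nat by lia.
    rewrite !Cpow_mult_r. change (cis tau ^ 2)%C with (qnome tau).
    change (Cprod (qfactor z tau) (S N)) with (Cprod (qfactor z tau) N * qfactor z tau (S N))%C.
    change (Cprod (fun n => 1 - qnome tau ^ n)%C (S N))
      with (Cprod (fun n => 1 - qnome tau ^ n)%C N * (1 - qnome tau ^ S N))%C.
    unfold qfactor. pose proof (one_minus_pow_neq_0 _ (S N) HQ ltac:(lia)).
    field. repeat split; auto using cis_neq_0.
- rewrite <- (Cmult_1_r ((1 - / cis z ^ 2) * (euler tau ^ 3 * Cinfprod (qfactor z tau)))%C).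
  apply (tends_mult eventually).
  + apply (tends_mult eventually); [apply (tends_const eventually) |].
    apply (tends_mult eventually); [| now apply qfactor_tends].
    now apply (tends_pow eventually), euler_tends.
  + replace (RtoC 1) with (1 * 1)%C at 1 by ring. rewrite <- (Cmult_1_l 1).
    apply (tends_mult eventually).
    * rewrite Cmult_1_l. apply (tends_subseq S (fun n => 1 - 1 * qnome tau ^ n)%C); [lia |].
      now apply one_minus_scal_pow_tends.
    * rewrite Cmult_1_l. apply (tends_subseq S (fun n => 1 - cis z ^ 2 * qnome tau ^ n)%C); [lia |].
      now apply one_minus_scal_pow_tends.
Qed.

(** At the half periods w^2 is -1, q and -q. The first gives (1 + Q^n)^2, which (1 - Q^n)^2
    completes to (1 - Q^(2n))^2; the other two combine into odd powers of Q = q^2. *)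
Lemma half_period_factors tau n : 0 < Im tau -> (1 <= n)%nat ->
  (qfactor (1 / 2) tau n * qfactor (tau / 2) tau n * qfactor (tau / 2 + 1 / 2) tau n
   * (1 - qnome tau ^ n) ^ 8)%C =
  ((1 - qnome tau ^ (2 * n)) ^ 2 * (1 - qnome tau ^ S (2 * n)) * (1 - qnome tau ^ (2 * n - 1)))%C.
Proof.
intros Ht Hn. pose proof (one_minus_pow_neq_0 _ n (qnome_lt_1 _ Ht) Hn) as H1.
assert (Hhalf : (cis (tau / 2) * cis (tau / 2))%C = cis tau).
{ rewrite <- cis_plus. f_equal. field. }
unfold qfactor. rewrite cis_plus, cis_half.
replace (Ci ^ 2)%C with (- (1))%C by (rewrite <- Ci_sqr; ring).
replace ((cis (tau / 2) * Ci) ^ 2)%C with (- cis tau)%C.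
2:{ replace ((cis (tau / 2) * Ci) ^ 2)%C with (cis (tau / 2) * cis (tau / 2) * (Ci * Ci))%C by ring.
    rewrite Hhalf, Ci_sqr. ring. }
replace (cis (tau / 2) ^ 2)%C with (cis tau) by (rewrite <- Hhalf; ring).
replace (/ - (1))%C with (- (1))%C by field.
destruct n as [|n]; [lia |].
replace (2 * S n - 1)%nat with (2 * n + 1)%nat by lia.
replace (qnome tau ^ S (2 * S n))%C with (qnome tau ^ 3 * (qnome tau ^ n) ^ 2)%C.
2:{ rewrite <- Cpow_mult_r, <- Cpow_add_r. f_equal. lia. }
replace (qnome tau ^ (2 * S n))%C with (qnome tau ^ 2 * (qnome tau ^ n) ^ 2)%C.
2:{ rewrite <- Cpow_mult_r, <- Cpow_add_r. f_equal. lia. }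
replace (qnome tau ^ (2 * n + 1))%C with (qnome tau * (qnome tau ^ n) ^ 2)%C.
2:{ rewrite <- Cpow_mult_r, Cpow_add_r, Cpow_1_r, (Nat.mul_comm n 2). ring. }
rewrite Cpow_S in *. set (X := (qnome tau ^ n)%C) in *. clearbody X.
unfold qnome in *.
field. repeat split; auto using cis_neq_0.
Qed.

(** With the additional factor 1 - Q, the even and odd powers reassemble into the square of Euler's
    product of length 2N, up to the end factor 1 - Q^(2N+1). *)
Lemma half_period_product tau : 0 < Im tau ->
  (theta (1 / 2) tau * theta (tau / 2) tau * theta (tau / 2 + 1 / 2) tau * euler tau ^ 6)%C =
  (2 / cis tau)%C.
Proof.
intros Ht. pose proof (qnome_lt_1 tau Ht) as HQ. set (Q := qnome tau) in *.
set (P := Cprod (fun n => 1 - Q ^ n)%C).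
assert (HPS : forall N, P (S N) = (P N * (1 - Q ^ S N))%C) by reflexivity.
assert (HE : forall N, (Cprod (fun n => qfactor (1 / 2) tau n * qfactor (tau / 2) tau n *
  qfactor (tau / 2 + 1 / 2) tau n)%C N * (1 - Q) * P N ^ 8)%C =
  (P (2 * N)%nat ^ 2 * (1 - 1 * Q ^ S (2 * N)))%C).
{ induction N as [|N IH].
  - unfold P. simpl. ring.
  - match goal with |- (Cprod ?f _ * _ * _)%C = _ =>
      change (Cprod f (S N)) with (Cprod f N * f (S N))%C end.
    cbv beta. rewrite HPS.
    replace (2 * S N)%nat with (S (S (2 * N))) at 1 by lia. rewrite !HPS.
    pose proof (half_period_factors tau (S N) Ht ltac:(lia)) as Hf. fold Q in Hf.
    replace (2 * S N - 1)%nat with (S (2 * N)) in Hf by lia.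
    replace (S (S (2 * N))) with (2 * S N)%nat by lia.
    match type of IH with (Cprod ?f _ * _ * _)%C = _ =>
    transitivity (Cprod f N * (1 - Q) * P N ^ 8 * (qfactor (1 / 2) tau (S N) *
      qfactor (tau / 2) tau (S N) * qfactor (tau / 2 + 1 / 2) tau (S N) * (1 - Q ^ S N) ^ 8))%C end;
      [ring |].
    rewrite IH, Hf. ring. }
set (E := (Cinfprod (qfactor (1 / 2) tau) * Cinfprod (qfactor (tau / 2) tau) *
  Cinfprod (qfactor (tau / 2 + 1 / 2) tau))%C).
pose proof (euler_neq_0 tau Ht) as Hne.
assert (Hlim : (E * (1 - Q) * euler tau ^ 8)%C = (euler tau ^ 2 * 1)%C).
{ apply (tends_unique eventually (fun N => Cprod (fun n => qfactor (1 / 2) tau n *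
    qfactor (tau / 2) tau n * qfactor (tau / 2 + 1 / 2) tau n)%C N * (1 - Q) * P N ^ 8)%C).
  - apply (tends_mult eventually).
    + apply (tends_mult eventually); [| apply (tends_const eventually)].
      apply (tends_ext eventually (fun N => Cprod (qfactor (1 / 2) tau) N *
        Cprod (qfactor (tau / 2) tau) N * Cprod (qfactor (tau / 2 + 1 / 2) tau) N)%C).
      { intros N. now rewrite !Cprod_mult. }
      apply (tends_mult eventually); [apply (tends_mult eventually) |]; now apply qfactor_tends.
    + now apply (tends_pow eventually), euler_tends.
  - apply (tends_ext eventually) with (1 := fun N => eq_sym (HE N)).
    apply (tends_mult eventually).
    + apply (tends_pow eventually), (tends_subseq (fun N => (2 * N)%nat) P); [lia |].
      now apply euler_tends.
    + apply (tends_subseq (fun N => S (2 * N)) (fun n => 1 - 1 * Q ^ n)%C); [lia |].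
      now apply one_minus_scal_pow_tends. }
assert (Hs : (csin (tau / 2) * csin (tau / 2 + 1 / 2))%C = (Ci * csin tau)%C).
{ replace tau with (2 * (tau / 2))%C at 3 by field. rewrite csin_double.
  transitivity (- (Ci * Ci) * (csin (tau / 2) * csin (tau / 2 + 1 / 2)))%C; [| ring].
  rewrite Ci_sqr. ring. }
assert (Hh : csin (1 / 2) = (2 * Ci)%C)
  by (unfold csin; rewrite cis_opp, cis_half, Ci_inv; ring).
unfold theta.
transitivity (csin (1 / 2) * (csin (tau / 2) * csin (tau / 2 + 1 / 2)) *
  (E * euler tau ^ 6))%C; [unfold E; ring |].
pose proof (one_minus_pow_neq_0 Q 1 HQ (le_n 1)) as H1. rewrite Cpow_1_r in H1.
replace (E * euler tau ^ 6)%C with (/ (1 - Q))%C.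
2:{ transitivity (euler tau ^ 2 * 1 / ((1 - Q) * euler tau ^ 2))%C; [field; auto |].
    rewrite <- Hlim. field. auto. }
rewrite Hs, Hh, csin_factored.
transitivity (- (Ci * Ci) * (2 / cis tau) * ((1 - cis tau ^ 2) / (1 - Q)))%C;
  [field; repeat split; auto using cis_neq_0 |].
rewrite Ci_sqr. change (cis tau ^ 2)%C with Q. field. repeat split; auto using cis_neq_0.
Qed.

(* The inversion at the three half periods, multiplied together. *)
Lemma eta3_sqr_inversion tau : 0 < Im tau ->
  (eta3 (-1 / tau) ^ 2)%C = (Ci * tau ^ 3 * eta3 tau ^ 2)%C.
Proof.
intros Ht. pose proof (tau_neq_0 tau Ht) as Ht0. pose proof (Im_inversion tau Ht) as Ht'.
set (tau' := (-1 / tau)%C) in *.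
pose proof (half_period_product tau Ht) as H1.
pose proof (half_period_product tau' Ht') as H2.
pose proof (euler_neq_0 tau Ht) as Hp. pose proof (euler_neq_0 tau' Ht') as Hp'.
pose proof (theta_eq_theta_inv (1 / 2) tau Ht) as Ea.
pose proof (theta_eq_theta_inv (tau / 2) tau Ht) as Eb.
(* Lowered by 1, the third half period divided by [tau] is exactly [tau' / 2 + 1 / 2]. The sign this
   costs cancels the one from [theta_opp] at the first half period. *)
pose proof (theta_eq_theta_inv (tau / 2 + 1 / 2 - 1) tau Ht) as Ec.
assert (Ec' : theta (tau / 2 + 1 / 2) tau = (- theta (tau / 2 + 1 / 2 - 1) tau)%C).
{ rewrite <- theta_plus_1 by exact Ht. f_equal. ring. }
unfold theta_inv in Ea, Eb, Ec. fold tau' in Ea, Eb, Ec.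
replace (1 / 2 / tau)%C with (- (tau' / 2))%C in Ea by (unfold tau'; field; exact Ht0).
rewrite theta_opp in Ea by exact Ht'.
replace (tau / 2 / tau)%C with (1 / 2)%C in Eb by (field; exact Ht0).
replace ((tau / 2 + 1 / 2 - 1) / tau)%C with (tau' / 2 + 1 / 2)%C in Ec
  by (unfold tau'; field; exact Ht0).
rewrite Ec', Ea, Eb, Ec in H1.
(* The three exponents add up to tau'/2 - tau/2 + 1/2, and the last term is the origin of the factor
   [Ci]. *)
assert (Hc : (cis (- ((1 / 2) ^ 2 / tau)) * cis (- ((tau / 2) ^ 2 / tau)) *
  cis (- ((tau / 2 + 1 / 2 - 1) ^ 2 / tau)))%C = (Ci * cis (tau' / 2) / cis (tau / 2))%C).
{ transitivity (Ci * cis (tau' / 2) * cis (- (tau / 2)))%C; [| now rewrite cis_opp].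
  rewrite <- cis_half, <- !cis_plus. f_equal. unfold tau'. field. exact Ht0. }
assert (Hsq : forall t : C, cis t = (cis (t / 2) ^ 2)%C).
{ intros t. replace (cis (t / 2) ^ 2)%C with (cis (t / 2) * cis (t / 2))%C by ring.
  rewrite <- cis_plus. f_equal. field. }
assert (Hsq4 : forall t : C, cis (t / 2) = (cis (t / 4) ^ 2)%C).
{ intros t. rewrite Hsq. do 2 f_equal. field. }
assert (E : (2 / cis tau)%C = (tau ^ 3 * (2 / cis tau') * (Ci * cis (tau' / 2) / cis (tau / 2))
  * euler tau ^ 6 / euler tau' ^ 6)%C).
{ rewrite <- H1, <- H2, <- Hc. field. exact Hp'. }
unfold eta3.
replace ((cis (tau' / 4) * euler tau' ^ 3) ^ 2)%C with (cis (tau' / 2) * euler tau' ^ 6)%C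
  by (rewrite Hsq4; ring).
replace ((cis (tau / 4) * euler tau ^ 3) ^ 2)%C with (cis (tau / 2) * euler tau ^ 6)%C
  by (rewrite Hsq4; ring).
rewrite (Hsq tau), (Hsq tau') in E.
pose proof (cis_neq_0 (tau / 2)) as Hq. pose proof (cis_neq_0 (tau' / 2)) as Hq'.
set (X := cis (tau / 2)) in *. set (Y := cis (tau' / 2)) in *.
transitivity (2 / X ^ 2 * (X ^ 2 * Y * euler tau' ^ 6 / 2))%C; [field; exact Hq |].
rewrite E. field. auto.
Qed.

(** * The principal square root and the sign of the multiplier *)

Lemma sqrt_unique_Re (a b : C) : (a ^ 2)%C = (b ^ 2)%C -> 0 < Re a -> 0 < Re b -> a = b.
Proof.
intros H Ha Hb.
assert (Hs : (a + b)%C <> RtoC 0).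
{ intros E. apply (f_equal Re) in E. destruct a, b. simpl in *. lra. }
replace a with (b + (a ^ 2 - b ^ 2) / (a + b))%C by (field; exact Hs).
rewrite H. field. exact Hs.
Qed.

Lemma Cpower_half_sqr (s : C) : s <> RtoC 0 -> (Cpower s (1 / 2) ^ 2)%C = s.
Proof.
intros Hs. unfold Cpower.
replace (Cexp (1 / 2 * Clog s) ^ 2)%C with (Cexp (1 / 2 * Clog s) * Cexp (1 / 2 * Clog s))%C by ring.
rewrite <- Cexp_plus.
replace (1 / 2 * Clog s + 1 / 2 * Clog s)%C with (Clog s) by field.
unfold Cexp, Clog. simpl Re. simpl Im.
rewrite exp_ln by now apply Cmod_gt_0. symmetry. now apply Carg_spec.
Qed.

(** A positive real part excludes the argument [PI], so half the argument lies strictly between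
    -PI/2 and PI/2. *)
Lemma Cpower_half_Re (s : C) : 0 < Re s -> 0 < Re (Cpower s (1 / 2)).
Proof.
intros Hs.
assert (Hs0 : s <> RtoC 0) by (intros E; rewrite E in Hs; simpl in Hs; lra).
destruct (Carg_spec s Hs0) as [[H1 H2] E].
assert (Hpi : Carg s <> PI).
{ intros Hpi. rewrite Hpi, cos_PI, sin_PI in E. pose proof (Cmod_ge_0 s) as Hm.
  apply (f_equal Re) in E. revert E Hm. generalize (Cmod s) as m. simpl. intros m E Hm.
  lra. }
unfold Cpower.
replace (1 / 2 * Clog s)%C with (ln (Cmod s) / 2, Carg s / 2)
  by (unfold Clog; rewrite <- RtoC_div by lra; apply C_eq; simpl; field).
unfold Cexp. simpl. rewrite Rmult_0_l, Rminus_0_r.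
apply Rmult_lt_0_compat; [apply exp_pos | apply cos_gt_0; lra].
Qed.

(** The quotient of eta cubes, expected to be (-i tau)^(3/2), divided by -i tau: the candidate for
    (-i tau)^(1/2). *)
Definition multiplier (tau : C) : C := (Ci * eta3 (-1 / tau) / (tau * eta3 tau))%C.

Lemma multiplier_sqr tau : 0 < Im tau -> (multiplier tau ^ 2)%C = (- Ci * tau)%C.
Proof.
intros Ht. pose proof (eta3_neq_0 tau Ht). pose proof (tau_neq_0 tau Ht).
transitivity ((Ci * Ci) * eta3 (-1 / tau) ^ 2 / (tau ^ 2 * eta3 tau ^ 2))%C;
  [unfold multiplier; field; auto |].
rewrite eta3_sqr_inversion, Ci_sqr by exact Ht. field. auto.
Qed.

(** A purely imaginary number has a square with real part at most 0, whereas [Re (- Ci * tau)] is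
    [Im tau > 0]. *)
Lemma multiplier_Re_neq_0 tau : 0 < Im tau -> Re (multiplier tau) <> 0.
Proof.
intros Ht H. pose proof (f_equal Re (multiplier_sqr tau Ht)) as E.
destruct (multiplier tau) as [a b], tau as [x y]. simpl in *. subst a. nra.
Qed.

Lemma multiplier_Ci : multiplier Ci = RtoC 1.
Proof.
assert (H : 0 < Im Ci) by (simpl; lra). unfold multiplier.
replace (-1 / Ci)%C with Ci.
- field. split; [now apply eta3_neq_0 | exact Ci_nz].
- transitivity (Ci * Ci / Ci)%C; [field; exact Ci_nz |]. rewrite Ci_sqr.
  f_equal. apply C_eq; simpl; ring.
Qed.

(** The segment from [Ci] to [tau] stays in the half-plane; a change of sign along it would produce
    a zero of the real part. *)
Lemma multiplier_Re_pos tau : 0 < Im tau -> 0 < Re (multiplier tau).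
Proof.
intros Ht.
set (path := fun t : R => (Ci + t * (tau - Ci))%C).
assert (HIm : forall t, 0 <= t <= 1 -> 0 < Im (path t)).
{ intros t Hts. unfold path. destruct tau as [x y]. simpl in *. nra. }
(* The real part is negated because [IVT_interv] expects a function going from negative to positive,
   and the value at t = 0 is that at [Ci], namely 1. *)
assert (Hcont : forall t, 0 <= t <= 1 -> continuity_pt (fun t => - Re (multiplier (path t))) t).
{ intros t Hts. specialize (HIm t Hts).
  assert (Hpath : tends (locally t) path (path t)).
  { apply (tends_plus (locally t)); [apply (tends_const (locally t)) |].
    apply (tends_mult (locally t)); [| apply (tends_const (locally t))].
    intros eps He. exists (mkposreal eps He). intros u Hu.
    rewrite <- RtoC_minus, Cmod_R. exact Hu. }
  apply continuity_pt_opp, continuity_pt_filterlim.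
  apply (tends_Re (locally t)).
  apply (tends_div (locally t)).
  - apply Cmult_neq_0; [now apply tau_neq_0 | now apply eta3_neq_0].
  - apply (tends_mult (locally t)); [apply (tends_const (locally t)) |].
    apply (eta3_continuous (locally t)); [now apply Im_inversion |].
    apply (tends_div (locally t));
      [now apply tau_neq_0 | apply (tends_const (locally t)) | exact Hpath].
  - apply (tends_mult (locally t)); [exact Hpath | now apply (eta3_continuous (locally t))]. }
assert (H0 : path 0 = Ci) by (unfold path; ring).
assert (H1 : path 1 = tau) by (unfold path; ring).
apply Rnot_le_lt. intros Hle.
destruct Hle as [Hlt | Heq]; [| now apply (multiplier_Re_neq_0 tau Ht)].
destruct (IVT_interv _ 0 1 Hcont) as [t [Hts Hz]].
- lra.
- rewrite H0, multiplier_Ci. simpl. lra.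
- rewrite H1. lra.
- apply (multiplier_Re_neq_0 (path t) (HIm t Hts)). lra.
Qed.

Theorem theorem1 : forall tau z : C, upper_half_plane tau ->
  theta1 (z / tau)%C (-1 / tau)%C =
  (- Ci * Cpower (- Ci * tau) (1 / 2) * Cexp (PI * Ci * z ^ 2 / tau)
   * theta1 z tau)%C.
Proof.
intros tau z Ht. unfold upper_half_plane in Ht.
pose proof (tau_neq_0 tau Ht) as Ht0.
assert (HRe : Re (- Ci * tau)%C = Im tau) by now rewrite <- Im_Re.
assert (Hm : multiplier tau = Cpower (- Ci * tau) (1 / 2)).
{ apply sqrt_unique_Re.
  - rewrite multiplier_sqr by exact Ht. symmetry. apply Cpower_half_sqr.
    intros E. rewrite E in HRe. simpl in HRe. lra.
  - now apply multiplier_Re_pos.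
  - apply Cpower_half_Re. lra. }
rewrite <- Hm, !theta1_theta by (try exact Ht; now apply Im_inversion).
replace (PI * Ci * z ^ 2 / tau)%C with (PI * Ci * (z ^ 2 / tau))%C by (field; exact Ht0).
fold (cis (z ^ 2 / tau)).
rewrite (theta_eq_theta_inv z tau Ht). unfold theta_inv, multiplier. rewrite cis_opp.
pose proof (eta3_neq_0 tau Ht).
(* Here -i is written as i^3, the three factors i that the right-hand side contains, so that [field]
   can conclude without i^2 = -1. *)
transitivity (Ci * (Ci * Ci) * eta3 (-1 / tau) * theta (z / tau) (-1 / tau))%C;
  [rewrite Ci_sqr; ring |].
field. repeat split; auto using cis_neq_0.
Qed.
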